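(* For any $\beta,\gamma\ge 0$, the joint distribution of $H_S^2$ and $R_S^2$ under the Palm probability of the max-signal point process $\mathcal V_S$ is given by the joint Laplace transform $$\mathbb E^0_{\mathcal V_S}\left[e^{-\gamma H_S^2-\beta R_S^2}\right]=\left(1+\frac{\beta}{\lambda\pi}\right)^{-1}\left(1+\frac{\gamma+\beta}{\lambda\pi}\right)^{-1/2}.$$
   Context: Model. Let $\lambda,v>0$. $\Phi=\sum_i\delta_{X_i}$ is a homogeneous Poisson point process of intensity $\lambda$ on $\mathbb R^2$ and $(\Theta_i)$ are i.i.d. uniform angles on $[-\pi,\pi)$, independent of $\Phi$. Base station (BS) $i$ is at $X_i^t=X_i+vt(\cos\Theta_i,\sin\Theta_i)$ at time $t\in\mathbb R$; $d_i(t)=\|X_i^t\|$ is its distance to the user at the origin. $T_i$ is the time at which $d_i$ is minimal and $H_i=d_i(T_i)$. The max-signal point process $\mathcal V_S$ consists of the times $s=T_i$ at which BS $i$ is the nearest BS (no other BS $j$ has $d_j(s)<H_i$). At such a time, $H_S=H_i$ and $R_S$ is the distance of the nearest interferer, i.e. of the second nearest BS at time $s$. Palm expectation: for a stationary point process $N$ on $\mathbb R$ with intensity $\lambda_N\in(0,\infty)$, built time-shift-compatibly from the moving configuration, $\mathbb E^0_N[f]=\lambda_N^{-1}\,\mathbb E\big[\sum_{t\in N\cap[0,1]}f_t\big]$, where $f_t$ is the quantity $f$ observed at time $t$. *)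

(* Defs.v *)
From HB Require Import structures.
From mathcomp Require Import all_boot all_order all_algebra.
From mathcomp Require Import finmap.
From mathcomp Require Import all_classical all_reals all_analysis.

Set Implicit Arguments.
Unset Strict Implicit.
Unset Printing Implicit Defensive.

Import Order.TTheory GRing.Theory Num.Theory.
Import numFieldNormedType.Exports.

Local Open Scope classical_set_scope.
Local Open Scope ring_scope.

Section independence.
Local Open Scope ereal_scope.
Context d (T : measurableType d) (R : realType) (P : probability T R).

Definition mutually_independent d' (E : measurableType d') (I : choiceType)
    (Y : I -> {RV P >-> E}) : Prop :=
  forall (J : {fset I}) (B : I -> set E), (forall i, measurable (B i)) ->
    P (\bigcap_(i in [set` J]) (Y i @^-1` B i)) =
    \prod_(i <- J) P (Y i @^-1` B i).

Definition generated_sigma d' (E : measurableType d') (I : Type)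
    (Y : I -> {RV P >-> E}) : set (set T) :=
  <<s \bigcup_(i in [set: I]) preimage_set_system setT (Y i) measurable >>.

(* Independence of the two families as wholes; nothing is said about
   independence inside each family. *)
Definition independent_families d1 (E1 : measurableType d1) (I1 : Type)
    (Y : I1 -> {RV P >-> E1}) d2 (E2 : measurableType d2) (I2 : Type)
    (Z : I2 -> {RV P >-> E2}) : Prop :=
  forall A B, generated_sigma Y A -> generated_sigma Z B ->
    P (A `&` B) = P A * P B.

End independence.

Section poisson_process.
Local Open Scope ereal_scope.
Context {R : realType}.

Definition area : set (R * R) -> \bar R :=
  (@lebesgue_measure R \x @lebesgue_measure R)%E.

Definition point_measure (x : nat -> R * R) : set (R * R) -> \bar R :=
  mseries (fun i => \d_(x i)) 0.

(* [poisson_prob] rather than [poisson_pmf]: the latter is constantly 1 at rate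
   0, which occurs for sets of area 0, whereas the former is then the Dirac mass
   at 0. The second argument of [poisson_prob] is ignored by its definition. *)
Definition is_poisson_process d (T : measurableType d) (P : probability T R)
    (lambda : R) (X : nat -> {RV P >-> (R * R)%type}) : Prop :=
  forall (n : nat) (B : 'I_n -> set (R * R)) (k : 'I_n -> nat),
    (forall j, measurable (B j)) -> (forall j, bounded_set (B j)) ->
    trivIset setT B ->
    P [set w | forall j, point_measure (fun i => X i w) (B j) = (k j)%:R%:E] =
    \prod_(j < n) poisson_prob (lambda * fine (area (B j))) 0%N [set k j].

End poisson_process.

Section uniform_angles.
Context {R : realType}.

Fact Npi_lt_pi : - pi < pi :> R.
Proof. by rewrite gtrN ?pi_gt0. Qed.

(* The uniform laws on [-pi, pi) and on [-pi, pi] are the same measure. *)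
Definition iid_uniform_angles d (T : measurableType d) (P : probability T R)
    (Theta : nat -> {RV P >-> R}) : Prop :=
  mutually_independent Theta /\
  forall i (B : set R), measurable B ->
    distribution P (Theta i) B = uniform_prob Npi_lt_pi B.

End uniform_angles.

(* Quantities determined by one realisation of the configuration: initial
   positions x and angles th. *)
Section configuration.
Context {R : realType}.
Variables (v : R) (x : nat -> R * R) (th : nat -> R).
Implicit Types (i j : nat) (s t : R).

Definition position i t : R * R :=
  ((x i).1 + v * t * cos (th i), (x i).2 + v * t * sin (th i)).

(* The library norm on R * R is the sup norm, hence the explicit formula. *)
Definition dist i t : R :=
  Num.sqrt ((position i t).1 ^+ 2 + (position i t).2 ^+ 2).

Definition closest_time i : R := get [set s | forall t, dist i s <= dist i t].

Definition closest_dist i : R := dist i (closest_time i).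

Definition serves_at s i : Prop :=
  s = closest_time i /\ ~ (exists2 j, j <> i & dist j s < closest_dist i).

Definition max_signal : set R := [set s | exists i, serves_at s i].

(* At a time s of [max_signal] the two distances below do not depend on which
   station [get] returns: tied stations are all at the minimal distance. *)
Definition serving_station s : nat := get (serves_at s).

Definition signal_dist s : R := closest_dist (serving_station s).

(* Distance of the second nearest station: the infimum is attained when the
   configuration is locally finite, which holds almost surely. *)
Definition interferer_dist s : R :=
  inf [set dist j s | j in [set j | j <> serving_station s]].

End configuration.

Section palm.
Local Open Scope ereal_scope.
Context d (T : measurableType d) (R : realType) (P : probability T R).
Variable N : T -> set R.

Definition intensity : \bar R :=
  \int[P]_w \esum_(t in N w `&` `[0%R, 1%R]) 1.

(* In \bar R, 0^-1 = +oo and +oo^-1 = 0, so that the value is 0 for [f] bounded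
   as soon as the intensity is 0 or +oo: a nonzero value entails that the
   intensity is positive and finite. *)
Definition palm_expectation (f : T -> R -> \bar R) : \bar R :=
  intensity^-1 * \int[P]_w \esum_(t in N w `&` `[0%R, 1%R]) f w t.

End palm.

(* Main.v *)
Require Import Defs.
From HB Require Import structures.
From mathcomp Require Import all_boot all_order all_algebra.
From mathcomp Require Import finmap ring lra.
From mathcomp Require Import all_classical all_reals all_analysis measurable_realfun.

(** The proof rests on one formula. Describe a station by its mark (y, a), the
initial position and the angle. Splitting y along and across the direction of
motion gives a time [tmin] and a signed [offset] with
d(t)^2 = offset^2 + v^2 (t - tmin)^2, so the station is closest at time [tmin],
at distance |offset| ([dist2E]). Let F(u, i) be the event that [tmin] of station
i lies in [0, 1] and that at that time every other station j satisfies
d_j^2 >= u + offset_i^2. Then, for c, u >= 0 ([far_law]),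
  sum_i E [1_{F(u, i)} exp (- c offset_i^2)]
    = lambda v sqrt (pi / (c + lambda pi)) exp (- lambda pi u).
The reason: seen from station i, the other stations at a fixed time form a
Poisson process of intensity lambda, which misses the disc of squared radius
u + h^2 with probability exp (- lambda pi (u + h^2)); and the measure
lambda dy U(da) on marks becomes lambda v dt dh in the coordinates (tmin, offset),
since a rotation preserves area. What remains is the Gaussian integral over h of
exp (- c h^2 - lambda pi (u + h^2)).

So, under the Palm probability, H^2 and R^2 - H^2 are independent and the latter
is exponential of rate lambda pi. Writing exp (- beta W) as
1 - int_0^W beta exp (- beta s) ds with W = R^2 - H^2 turns the tail formula into
the Laplace transform ([layer_cake], [weighted_mass]); the case c = u = 0 is the
intensity, and the quotient of the two is the claim.

Two points need care. The first is that both the time and the radius of the disc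
depend on station i. At a fixed time and radius the formula is [marked_campbell].
It is obtained from the finite-dimensional laws alone: given the positions, the
independent angles let each point y avoid the disc with a probability f(y), and
sum_i 1_B(X_i) prod_{j != i} f(X_j) has a computable mean because, when f takes
finitely many values, it is a function of finitely many independent Poisson counts
([label_sum], [label_expectation], [campbell_void]); independence of the positions
and the angles enters as a Fubini formula ([ge0_integral_families]). To reach
random times and radii, both are rounded to a grid of mesh 1/(N+1); distances are
Lipschitz in time, so that rounding costs a change of radius of order 1/N
([far_avoid], [avoid_far]), and N tends to infinity ([far_upper], [far_lower]).

The second is that the Palm expectation sums over times and not over stations.
Two stations could share a time only in case of a tie, that is on F(0, i) outside
the union of the F(u, i) with u > 0; by continuity in u of the formula this has
probability 0 ([ties_null]), and the sum over times is almost surely the sum over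
stations ([esum_max_signal], [palm_sum]). *)

Set Implicit Arguments.
Unset Strict Implicit.
Unset Printing Implicit Defensive.

Import Order.TTheory GRing.Theory Num.Theory.
Import numFieldNormedType.Exports.

Local Open Scope classical_set_scope.
Local Open Scope ring_scope.

(** * Lebesgue measure on the line and on the plane *)

Section leb.
Context {R : realType}.
Local Open Scope ereal_scope.
(** Lebesgue measure carried by the Borel structure that R has by default, which is the one random
variables with values in R refer to. *)
Definition leb : set R -> \bar R := @lebesgue_measure R.

Let leb0 : leb set0 = 0. Proof. exact: measure0. Qed.
Let leb_ge0 A : 0 <= leb A. Proof. exact: measure_ge0. Qed.
Let leb_sigma_additive : semi_sigma_additive leb.
Proof. exact: (@measure_semi_sigma_additive _ _ _ (@lebesgue_measure R)). Qed.
HB.instance Definition _ := isMeasure.Build _ _ _ leb leb0 leb_ge0 leb_sigma_additive.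

Let leb_sigma_finite : sigma_finite setT leb.
Proof. exact: (sigma_finiteT (@lebesgue_measure R)). Qed.
HB.instance Definition _ := Measure_isSigmaFinite.Build _ _ _ leb leb_sigma_finite.

Let idm : measurable_fun setT (fun x : measurableTypeR R => x : R).
Proof. by move=> _ A mA; rewrite setTI. Qed.

Lemma ge0_integral_leb (D : set R) (f : R -> \bar R) : measurable D -> measurable_fun D f ->
  (forall x, D x -> 0 <= f x) ->
  \int[leb]_(x in D) f x = \int[lebesgue_measure]_(x in D) f x.
Proof.
move=> mD mf f0.
rewrite -(@ge0_integral_pushforward _ _ _ _ _ (fun x : measurableTypeR R =>
  x : R) idm (@lebesgue_measure R) D f)//.
by move=> x /[!inE]; exact: f0.
Qed.

Lemma leb_itv (b0 b1 : bool) (a b : R) : (a <= b)%R ->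
  leb [set` Interval (BSide b0 a) (BSide b1 b)] = (b - a)%:E.
Proof.
have := @lebesgue_measure_itv R (Interval (BSide b0 a) (BSide b1 b)).
rewrite /leb /= lte_fin => ->; rewrite le_eqVlt => /orP[/eqP ->|->//].
by rewrite ltxx subrr.
Qed.

Lemma areaE A : measurable A -> @area R A = (leb \x leb) A.
Proof.
move=> mA.
rewrite /area /product_measure1 [RHS]ge0_integral_leb//.
exact: measurable_fun_xsection.
Qed.
End leb.

Section semicircle.
Context {R : realType}.

(** Substitute x = r sin t; the integrand becomes 2 r^2 (cos t)^2, the derivative of
r^2 (t + sin t cos t). *)
Lemma integral_semicircle (r : R) : (0 <= r)%R ->
  (\int[lebesgue_measure]_(x in [set` `[(- r)%R, r]]) (2 * Num.sqrt (r ^+ 2 - x ^+ 2))%:E =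
  (pi * r ^+ 2)%:E)%E.
Proof.
move=> r0.
have pi2 : (- (pi / 2) < pi / 2 :> R)%R by have := pi_gt0 R; lra.
have -> : `[(- r)%R, r] = `[(r * sin (- (pi / 2)))%R, (r * sin (pi / 2))%R].
  by rewrite sinN sin_pihalf; congr `[_, _]; ring.
move: r0; rewrite le_eqVlt => /orP[/eqP <-|r0].
  rewrite !mul0r set_itv1 integral_set1; congr EFin; lra.
have dF (x : R) : is_derive x (1 : R) (fun x : R => r * sin x)%R (r * cos x)%R.
  by apply: is_derive_eq; rewrite /GRing.scale/=; ring.
have F'E : ((fun x : R => r * sin x)^`()%classic = fun x => r * cos x)%R.
  by apply/funext => x; rewrite derive1E derive_val.
have cF' : continuous (fun x : R => r * cos x)%R.
  by move=> x; apply: cvgM; [exact: cvg_cst|exact: continuous_cos].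
have cF : continuous (fun x : R => r * sin x)%R.
  by move=> x; apply: cvgM; [exact: cvg_cst|exact: continuous_sin].
rewrite (@integration_by_substitution_increasing _ (fun x => r * sin x)%R); last first.
- apply: continuous_subspaceT => x; apply: cvgM; first exact: cvg_cst.
  apply: continuous_comp; last exact: sqrt_continuous.
  by apply: cvgB; [exact: cvg_cst|exact: exprn_continuous].
- split; first by move=> x _; exact: (@ex_derive _ _ _ _ _ _ _ (dF x)).
  + by apply: cvg_at_right_filter; exact: cF.
  + by apply: cvg_at_left_filter; exact: cF.
- by rewrite F'E; apply: cvgP; apply: cvg_at_left_filter; exact: cF'.
- by rewrite F'E; apply: cvgP; apply: cvg_at_right_filter; exact: cF'.
- by rewrite F'E => x _; exact: cF'.
- by move=> x y xI yI xy; rewrite ltr_pM2l// ltr_sin.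
- exact: ltW.
have dG (x : R) : is_derive x (1 : R) (fun x : R => r ^+ 2 * (x + sin x * cos x))%R
   (2 * r ^+ 2 * cos x ^+ 2)%R.
  apply: is_derive_eq; rewrite /GRing.scale/=.
  have := cos2Dsin2 x; move: (sin x) (cos x) => a b ab.
  have a2 : a ^+ 2 = 1 - b ^+ 2 by rewrite -ab addrAC subrr add0r.
  by transitivity (r ^+ 2 * (1 + b ^+ 2 - a ^+ 2)); [ring|rewrite a2; ring].
have jac x : (- (pi / 2) < x < pi / 2)%R -> (2 * Num.sqrt (r ^+ 2 - (r * sin x) ^+ 2) *
    (r * cos x) = 2 * r ^+ 2 * cos x ^+ 2)%R.
  move=> xI; rewrite (_ : r ^+ 2 - (r * sin x) ^+ 2 = (r * cos x) ^+ 2)%R; last first.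
    by rewrite !exprMn cos2sin2; ring.
  rewrite sqrtr_sqr ger0_norm; first ring.
  by rewrite mulr_ge0 ?cos_ge0_pihalf// ?ltW//; lra.
rewrite F'E (@continuous_FTC2 _ _ (fun x : R => r ^+ 2 * (x + sin x * cos x))%R)//=.
- by rewrite sinN cosN cos_pihalf -EFinB; congr EFin; lra.
- apply: continuous_subspaceT => x; apply: cvgM; last exact: cF'.
  apply: cvgM; first exact: cvg_cst.
  apply: continuous_comp; last exact: sqrt_continuous.
  apply: cvgB; [exact: cvg_cst|].
  apply: (@continuous_comp _ _ _ (fun x => r * sin x) (fun y : R => y ^+ 2)).
    exact: cF.
  exact: exprn_continuous.
- have cG : continuous (fun x : R => r ^+ 2 * (x + sin x * cos x))%R.
    by move=> x; apply/differentiable_continuous/derivable1_diffP; case: (dG x).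
  split; first by move=> x _; case: (dG x).
  + by apply: cvg_at_right_filter; exact: cG.
  + by apply: cvg_at_left_filter; exact: cG.
- by move=> x; rewrite in_itv/= => xI; rewrite derive1E derive_val -(jac x xI).
Qed.

End semicircle.

Section plane.
Context {R : realType}.
Local Open Scope ereal_scope.
Notation mu := (@lebesgue_measure R).

Lemma leb_translation (a : R) (A : set R) : measurable A ->
  pushforward leb (fun x => x + a)%R A = leb A.
Proof.
move=> mA; suff : pushforward mu ((fun x => x + a)%R : _ -> measurableTypeR R) A = mu A by [].
apply/esym/lebesgue_measure_unique => //=.
  exact: measurable_funD.
move=> mf _ [[b c]] _ <-.
rewrite /pushforward (_ : (fun x : R => x + a)%R @^-1` _ =
  [set` `]b - a, c - a]%R]); last first.
  by apply/seteqP; split => x /=; rewrite !in_itv/= ltrBlDr lerBrDr.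
rewrite !lebesgue_measure_itv/= !lte_fin ltrD2r; case: ifPn => // _.
by rewrite -!EFinB; congr EFin; lra.
Qed.

Lemma ge0_integral_translation (a : R) (f : R -> \bar R) :
  measurable_fun setT f -> (forall x, 0 <= f x) ->
  \int[leb]_x f (x + a)%R = \int[leb]_x f x.
Proof.
move=> mf f0.
have mg : measurable_fun setT (fun x : R => x + a)%R by exact: measurable_funD.
rewrite -(@ge0_integral_pushforward _ _ _ _ _ _ mg leb setT f)//.
by apply: eq_measure_integral => A mA _; exact: leb_translation.
Qed.

Definition leb2 : set (R * R)%type -> \bar R := leb \x leb.
HB.instance Definition _ := Measure.on leb2.

Definition box (n : nat) : set (R * R)%type :=
  [set` `[- n%:R, n%:R]%R] `*` [set` `[- n%:R, n%:R]%R].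

Lemma measurable_box n : measurable (box n).
Proof. exact: measurableX. Qed.

Lemma leb2_box_lty n : leb2 (box n) < +oo.
Proof.
rewrite /leb2 product_measure1E//= !leb_itv ?ltry//.
all: by rewrite lerNl (@le_trans _ _ 0%R)// oppr_le0.
Qed.

Lemma box_cover : \bigcup_n box n = setT.
Proof.
apply/seteqP; split => // -[x y] _; pose M := Num.max `|x|%R `|y|%R.
have M0 : (0 <= M)%R by rewrite le_max normr_ge0.
have [xM yM] : (`|x| <= M /\ `|y| <= M)%R by rewrite !le_max !lexx orbT.
have MN : (M <= (Num.truncn M).+1%:R)%R by rewrite ltW// truncnS_gt.
exists (Num.truncn M).+1 => //; split => /=.
  by rewrite in_itv/= -ler_norml (le_trans xM).
by rewrite in_itv/= -ler_norml (le_trans yM).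
Qed.

Let leb2_sigma_finite : sigma_finite setT leb2.
Proof.
exists box; first exact/esym/box_cover.
by move=> n; split; [exact: measurable_box|exact: leb2_box_lty].
Qed.
HB.instance Definition _ := Measure_isSigmaFinite.Build _ _ _ leb2 leb2_sigma_finite.

Lemma ge0_integral_leb2 (f : R * R -> \bar R) :
  measurable_fun setT f -> (forall z, 0 <= f z) ->
  \int[leb2]_z f z = \int[leb]_x \int[leb]_y f (x, y).
Proof. by move=> mf f0; rewrite fubini_tonelli1. Qed.

Lemma ge0_integral_leb2_swap (f : R * R -> \bar R) :
  measurable_fun setT f -> (forall z, 0 <= f z) ->
  \int[leb2]_z f z = \int[leb]_y \int[leb]_x f (x, y).
Proof. by move=> mf f0; rewrite fubini_tonelli2. Qed.

Lemma measurable_lin2 (a b c : R) :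
  measurable_fun [set: R * R] (fun z : R * R => a * z.1 + b * z.2 + c)%R.
Proof.
apply: measurable_funD => //.
by apply: measurable_funD; apply: measurable_funM.
Qed.

Lemma measurable_aff (a b c a' b' c' : R) :
  measurable_fun [set: R * R]
   (fun z : R * R => (a * z.1 + b * z.2 + c, a' * z.1 + b' * z.2 + c'))%R.
Proof. by apply: measurable_fun_pair; exact: measurable_lin2. Qed.

Lemma measurable_comp_aff (a b c a' b' c' : R) (f : R * R -> \bar R) (g : R * R -> R * R) :
  measurable_fun setT f ->
  (forall z, g z = (a * z.1 + b * z.2 + c, a' * z.1 + b' * z.2 + c')%R) ->
  measurable_fun setT (fun z => f (g z)).
Proof.
move=> mf gE; apply: (measurableT_comp mf).
rewrite (_ : g = fun z => (a * z.1 + b * z.2 + c, a' * z.1 + b' * z.2 + c')%R); last exact/funext.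
exact: measurable_aff.
Qed.

Lemma measurable_shear1 (k : R) (f : R * R -> \bar R) : measurable_fun setT f ->
  measurable_fun setT (fun z : R * R => f (z.1 + k * z.2, z.2)%R).
Proof.
by move=> mf; apply: (@measurable_comp_aff 1 k 0 0 1 0) => // z; congr (_, _); lra.
Qed.

Lemma measurable_shear2 (k : R) (f : R * R -> \bar R) : measurable_fun setT f ->
  measurable_fun setT (fun z : R * R => f (z.1, z.2 + k * z.1)%R).
Proof.
by move=> mf; apply: (@measurable_comp_aff 1 0 0 k 1 0) => // z; congr (_, _); lra.
Qed.

Lemma ge0_integral_shear1 (k : R) (f : R * R -> \bar R) :
  measurable_fun setT f -> (forall z, 0 <= f z) ->
  \int[leb2]_z f (z.1 + k * z.2, z.2)%R = \int[leb2]_z f z.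
Proof.
move=> mf f0; rewrite (@ge0_integral_leb2_swap (fun z => f (z.1 + k * z.2, z.2)%R))//;
  last exact: measurable_shear1.
rewrite [RHS](ge0_integral_leb2_swap mf f0); apply: eq_integral => y _ /=.
rewrite (@ge0_integral_translation (k * y) (fun x => f (x, y)))//.
exact: measurableT_comp mf _.
Qed.

Lemma ge0_integral_shear2 (k : R) (f : R * R -> \bar R) :
  measurable_fun setT f -> (forall z, 0 <= f z) ->
  \int[leb2]_z f (z.1, z.2 + k * z.1)%R = \int[leb2]_z f z.
Proof.
move=> mf f0; rewrite (@ge0_integral_leb2 (fun z => f (z.1, z.2 + k * z.1)%R))//;
  last exact: measurable_shear2.
rewrite [RHS](ge0_integral_leb2 mf f0); apply: eq_integral => x _ /=.
rewrite (@ge0_integral_translation (k * x) (fun y => f (x, y)))//.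
exact: measurableT_comp mf _.
Qed.

(** A rotation by an angle that is not a multiple of pi is a product of three shears, and a shear
is a translation on each line, so both preserve area. A half-turn is the square of a
quarter-turn. *)
Lemma ge0_integral_rotation (c s : R) (f : R * R -> \bar R) :
  (c ^+ 2 + s ^+ 2 = 1)%R -> measurable_fun setT f -> (forall z, 0 <= f z) ->
  \int[leb2]_z f (c * z.1 - s * z.2, s * z.1 + c * z.2)%R = \int[leb2]_z f z.
Proof.
have main c' s' (g : R * R -> \bar R) : (c' ^+ 2 + s' ^+ 2 = 1)%R -> s' != 0%R ->
    measurable_fun setT g -> (forall z, 0 <= g z) ->
    \int[leb2]_z g (c' * z.1 - s' * z.2, s' * z.1 + c' * z.2)%R = \int[leb2]_z g z.
  move=> cs s0 mg g0; pose t : R := ((1 - c') / s')%R.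
  pose g1 (z : R * R) := g (z.1 + - t * z.2, z.2)%R.
  pose g2 (z : R * R) := g1 (z.1, z.2 + s' * z.1)%R.
  have mg1 : measurable_fun setT g1 by exact: measurable_shear1.
  have mg2 : measurable_fun setT g2 by exact: measurable_shear2.
  have <- : \int[leb2]_z g1 z = \int[leb2]_z g z by exact: ge0_integral_shear1.
  have <- : \int[leb2]_z g2 z = \int[leb2]_z g1 z.
    by apply: ge0_integral_shear2 => // z; exact: g0.
  have <- : \int[leb2]_z g2 (z.1 + - t * z.2, z.2)%R = \int[leb2]_z g2 z.
    by apply: ge0_integral_shear1 => // z; exact: g0.
  have ts : (t * s' = 1 - c')%R by rewrite /t divfK.
  have tc : (t * (1 + c') = s')%R.
    apply: (mulIf s0); rewrite mulrAC ts -expr2.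
    by rewrite (_ : s' ^+ 2 = 1 - c' ^+ 2)%R; [ring|rewrite -cs addrAC subrr add0r].
  apply: eq_integral => z _; rewrite /g2 /g1 /=; congr (g (_, _)).
    rewrite -[in LHS]tc; move: (z.1) (z.2) => a b.
    transitivity (a - t * b - t * b - (t * s') * (a - t * b))%R; last by ring.
    by rewrite ts; ring.
  move: (z.1) (z.2) => a b.
  transitivity (b + s' * a - (t * s') * b)%R; last by ring.
  by rewrite ts; ring.
move=> cs mf f0; have [s0|] := eqVneq s 0%R; last by move=> s0; exact: main.
have : ((c == 1) || (c == - 1))%R by rewrite -eqf_sqr expr1n; apply/eqP; rewrite -cs s0; lra.
case/orP => /eqP ->; rewrite s0.
  by apply: eq_integral => -[a b] _ /=; congr (f (_, _)); lra.
have c01 : (0 ^+ 2 + 1 ^+ 2 = 1 :> R)%R by lra.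
rewrite -[RHS](main 0%R 1%R)// ?oner_neq0//.
rewrite -[RHS](main 0%R 1%R) ?oner_neq0//; last first.
  apply: (@measurable_comp_aff 0 (-1) 0 1 0 0 f) => // z.
  by congr (_, _); lra.
by apply: eq_integral => -[a b] _ /=; congr (f (_, _)); lra.
Qed.

Lemma ge0_integral_leb2_translation (w : R * R) (f : R * R -> \bar R) :
  measurable_fun setT f -> (forall z, 0 <= f z) ->
  \int[leb2]_z f (z.1 + w.1, z.2 + w.2)%R = \int[leb2]_z f z.
Proof.
move=> mf f0.
have mfw : measurable_fun setT (fun z : R * R => f (z.1 + w.1, z.2 + w.2)%R).
  by apply: (@measurable_comp_aff 1 0 w.1 0 1 w.2 f) => // z; congr (_, _); lra.
rewrite (ge0_integral_leb2 mfw); last by move=> z; exact: f0.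
rewrite (ge0_integral_leb2 mf f0).
have mF : measurable_fun setT (fun x => \int[leb]_y f (x, y)).
  exact: (@measurable_fun_fubini_tonelli_F _ _ _ _ _ leb _ mf f0).
have F0 x : 0 <= \int[leb]_y f (x, y) by exact: integral_ge0.
rewrite -(ge0_integral_translation w.1 mF F0).
apply: eq_integral => x _ /=.
rewrite (@ge0_integral_translation w.2 (fun y => f (x + w.1, y)%R))//.
exact: measurableT_comp mf _.
Qed.

(** This is the total mass of the normal density of variance 1 / (2 k). *)
Lemma integral_gaussian (k : R) : (0 < k)%R ->
  \int[mu]_h (expR (- k * h ^+ 2))%:E = (Num.sqrt (pi / k))%:E.
Proof.
move=> k0; pose s := (Num.sqrt (2 * k)^-1)%R.
have s0 : s != 0%R by rewrite gt_eqF// sqrtr_gt0 invr_gt0; lra.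
have s2 : (s ^+ 2 *+ 2 = k^-1)%R.
  rewrite sqr_sqrtr ?invr_ge0; last lra.
  by field; rewrite gt_eqF.
have p0 : (0 < normal_peak s)%R by exact: normal_peak_gt0.
have := integral_normal_pdf 0%R s.
rewrite normal_pdfE//.
under eq_integral do rewrite EFinM.
rewrite ge0_integralZl//=; last 3 first.
- by apply/measurable_EFinP; exact: measurable_normal_fun.
- by move=> h _; rewrite lee_fin normal_fun_ge0.
- by rewrite lee_fin ltW.
have -> : \int[mu]_h (normal_fun 0%R s h)%:E = \int[mu]_h (expR (- k * h ^+ 2))%:E.
  by apply: eq_integral => h _; rewrite /normal_fun s2 subr0 invrK; congr (expR _)%:E; ring.
have -> : (Num.sqrt (pi / k) = (normal_peak s)^-1)%R.
  by rewrite /normal_peak invrK -mulrnAl s2 mulrC.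
case: (\int[mu]_h _) => [r [pr]| |].
- by congr EFin; rewrite -[RHS]mulr1 -pr mulKf// gt_eqF.
- by rewrite gt0_muley ?lte_fin.
- by rewrite gt0_muleNy ?lte_fin.
Qed.

Lemma leb2_disc (r : R) : (0 <= r)%R ->
  leb2 [set z | (z.1 ^+ 2 + z.2 ^+ 2 < r ^+ 2)%R] = (pi * r ^+ 2)%:E.
Proof.
move=> r0; rewrite -integral_semicircle//.
have mf : measurable_fun [set` `[(- r)%R, r]]
    (fun x : R => (2 * Num.sqrt (r ^+ 2 - x ^+ 2))%:E).
  apply: measurable_funTS; apply/measurable_EFinP; apply: measurable_funM => //.
  apply: measurableT_comp.
    exact: continuous_measurable_fun (@sqrt_continuous R).
  exact: measurable_funB.
rewrite -(ge0_integral_leb (measurable_itv _) mf); last by move=> x _; rewrite lee_fin mulr_ge0.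
rewrite [RHS]integral_mkcond; apply: eq_integral => x _ /=.
rewrite patchE; set A := xsection _ _.
have AE : A = [set y | (x ^+ 2 + y ^+ 2 < r ^+ 2)%R].
  by apply/seteqP; split => y; rewrite /A /xsection/= inE.
case: ifPn => [|]; rewrite ?notin_setE ?inE/= in_itv/= => xr.
  rewrite (_ : A = [set` `](- Num.sqrt (r ^+ 2 - x ^+ 2))%R, Num.sqrt (r ^+ 2 - x ^+ 2)[]).
    rewrite leb_itv; first by congr EFin; ring.
    by rewrite lerNl (@le_trans _ _ 0%R)// ?oppr_le0 sqrtr_ge0.
  apply/seteqP; rewrite AE; split => y /=; rewrite in_itv/= -ltr_norml -sqrtr_sqr.
    by move=> xyr; rewrite ltr_sqrt; [lra|have := sqr_ge0 y; lra].
  by rewrite ltNge => h; rewrite ltNge; apply: contra h => h; rewrite ler_wsqrtr//; lra.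
rewrite (_ : A = set0) ?measure0// AE -subset0 => y /= xyr; apply: xr.
rewrite -ler_norml -(ler_pXn2r (ltn0Sn 1)) ?nnegrE// real_normK ?num_real//.
by have := sqr_ge0 y; lra.
Qed.
End plane.

(** * Products of functions of independent counts *)

Section product_rule.
Context d (T : measurableType d) (R : realType) (P : probability T R).
Variables (n : nat) (K : 'I_n -> T -> nat) (p : 'I_n -> nat -> R).
Hypothesis mK : forall j k, measurable [set w | K j w = k].
Hypothesis p_ge0 : forall j k, 0 <= p j k.
Hypothesis PK : forall k : 'I_n -> nat,
  P [set w | forall j, K j w = k j] = (\prod_j p j (k j))%:E.

Lemma measurable_natfun (j : 'I_n) (h : nat -> R) :
  measurable_fun setT (fun w => h (K j w)).
Proof.
move=> _ B mB; rewrite setTI.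
rewrite (_ : _ @^-1` _ = \bigcup_(k in [set k | B (h k)]) [set w | K j w = k]).
  by apply: bigcup_measurable => k _; exact: mK.
apply/seteqP; split => [w /= Bw|w [k /= Bk Kw]]; last by rewrite Kw.
by exists (K j w).
Qed.

(** Used to decompose a function according to the value of an integer-valued label. *)
Lemma nneseries_single (f : nat -> R) (a : nat) : (forall k, 0 <= f k) ->
  (\sum_(l <oo) ((l == a)%:R * f l)%:E = (f a)%:E)%E.
Proof.
move=> f0; rewrite (@nneseriesD1 R _ a xpredT)//; last by move=> k _; rewrite lee_fin mulr_ge0.
rewrite eqxx mul1r eseries0 ?adde0// => k _ /negbTE ->.
by rewrite mul0r.
Qed.

(** Integer-valued variables are discrete, so their joint law given by [PK] determines the mean of a
product. The induction replaces one indicator of {K j = k j} at a time by h j: summing the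
identity for k j = l against h j l gives the next one. *)
Lemma expectation_prod (h : 'I_n -> nat -> R) (s : 'I_n -> R) :
  (forall j k, 0 <= h j k) ->
  (forall j, \sum_(k <oo) (h j k * p j k)%:E = (s j)%:E)%E ->
  (\int[P]_w (\prod_j h j (K j w))%:E = (\prod_j s j)%:E)%E.
Proof.
move=> h0 hs.
pose hm m (k : 'I_n -> nat) (j : 'I_n) (l : nat) : R :=
  if (j < m)%N then h j l else (l == k j)%:R.
pose sm m (k : 'I_n -> nat) (j : 'I_n) := if (j < m)%N then s j else p j (k j).
have hm0 m k j l : 0 <= hm m k j l by rewrite /hm; case: ifP.
suff main m : (m <= n)%N -> forall k,
    (\int[P]_w (\prod_j hm m k j (K j w))%:E = (\prod_j sm m k j)%:E)%E.
  have := main _ (leqnn n) (fun=> 0%N).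
  have E1 (k : 'I_n -> nat) w : \prod_j hm n k j (K j w) = \prod_j h j (K j w).
    by apply: eq_bigr => j _; rewrite /hm ltn_ord.
  under eq_integral do rewrite E1.
  move=> ->; congr EFin; by apply: eq_bigr => j _; rewrite /sm ltn_ord.
have mprod m0 k : measurable_fun setT (fun w => (\prod_j hm m0 k j (K j w))%:E).
  apply/measurable_EFinP; apply: measurable_prod => j _.
  exact: measurable_natfun.
elim: m => [_ k|m IH mn k].
  transitivity (\int[P]_w (\1_[set w | forall j, K j w = k j] w)%:E)%E.
    apply: eq_integral => w _; congr EFin; rewrite indicE.
    case: (boolP (w \in _)) => [|]; rewrite ?notin_setE ?inE/= => Kw.
      by rewrite big1// => j _; rewrite /hm /= Kw eqxx.
    have [j Kj] : exists j, K j w != k j.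
      by apply/not_existsP => H; apply: Kw => j; apply/eqP/negPn/negP => /H.
    by rewrite (bigD1 j)//= /hm/= (negbTE Kj) mul0r.
  have mE : measurable [set w | forall j, K j w = k j].
    rewrite (_ : [set w | _] = \bigcap_(j in [set: 'I_n]) [set w | K j w = k j]).
      by apply: fin_bigcap_measurable => [|j _]; [exact: finite_finset|exact: mK].
    by apply/seteqP; split => [w Kw j _|w Kw j]; [exact: Kw|exact: Kw j I].
  by rewrite integral_indic// setIT; exact: PK.
pose i := Ordinal mn.
pose upd l j := if j == i then l else k j.
have E w : ((\prod_j hm m.+1 k j (K j w))%:E =
    \sum_(l <oo) (h i l)%:E * (\prod_j hm m (upd l) j (K j w))%:E)%E.
  have E1 l : ((h i l)%:E * (\prod_j hm m (upd l) j (K j w))%:E)%E =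
     ((l == K i w)%:R * (h i l * \prod_(j | j != i) hm m.+1 k j (K j w)))%:E.
    rewrite -EFinM (bigD1 i)//= {1}/hm ltnn /upd eqxx eq_sym mulrCA.
    congr (_ * (_ * _))%:E; apply: eq_bigr => j ji; rewrite /hm ltnS (negbTE ji).
    by rewrite [in RHS]leq_eqVlt; have /negbTE -> : (nat_of_ord j != m) by apply: contra ji =>
      /eqP ?; apply/eqP/val_inj.
  under eq_eseriesr do rewrite E1.
  rewrite nneseries_single; last by move=> l; rewrite mulr_ge0// prodr_ge0.
  by rewrite [in LHS](bigD1 i)//= {1}/hm ltnSn.
under eq_integral do rewrite E.
rewrite integral_nneseries//; last 2 first.
- by move=> l; apply: measurable_funeM.
- by move=> l w _; rewrite mule_ge0 ?lee_fin// prodr_ge0.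
under eq_eseriesr.
  move=> l _; rewrite ge0_integralZl_EFin//; last first.
    by move=> w _; rewrite lee_fin prodr_ge0.
  rewrite IH ?(ltnW mn)// (bigD1 i)//= {1}/sm ltnn /upd eqxx.
  rewrite (eq_bigr (sm m.+1 k)); last first.
    move=> j ji; rewrite /sm ltnS (negbTE ji) [in RHS]leq_eqVlt.
    by have /negbTE -> : (nat_of_ord j != m) by apply: contra ji => /eqP ?; apply/eqP/val_inj.
  rewrite -EFinM mulrA mulrC EFinM.
  over.
rewrite nneseriesZl; last by move=> l _; rewrite lee_fin mulr_ge0.
by rewrite hs [in RHS](bigD1 i)//= {2}/sm ltnSn -EFinM mulrC.
Qed.

End product_rule.

(** * Generating functions of the Poisson law *)

Section poisson_series.
Context {R : realType}.
Implicit Types (x q m : R) (k : nat).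

Definition pois m k : R := m ^+ k / k`!%:R * expR (- m).

Lemma pois_ge0 m k : 0 <= m -> 0 <= pois m k.
Proof. by move=> m0; rewrite !mulr_ge0 ?exprn_ge0// invr_ge0. Qed.

Lemma poisson_prob1 m k : 0 <= m -> poisson_prob m 0%N [set k] = (pois m k)%:E.
Proof.
move=> m0; rewrite /poisson_prob; case: ifPn => [m_gt0|].
  by rewrite esum_set1 ?lee_fin ?poisson_pmf_ge0// /poisson_pmf m_gt0.
rewrite -leNgt => m_le0; have -> : m = 0 by apply/eqP; rewrite eq_le m_le0.
rewrite diracE /pois oppr0 expR0 mulr1 expr0n.
case: (boolP (0%N \in [set k])) => [|]; rewrite ?notin_setE ?inE/=.
  by move=> <-; rewrite eqxx fact0 divr1.
by move/eqP => k0; rewrite eq_sym (negbTE k0) mul0r.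
Qed.

Lemma exp_series x : 0 <= x -> (\sum_(k <oo) (x ^+ k / k`!%:R)%:E = (expR x)%:E)%E.
Proof.
move=> x0; rewrite [X in (_ = X%:E)%E](_ : _ = limn (series (exp_coeff x)))// -EFin_lim;
  last exact: is_cvg_series_exp_coeff.
by apply/congr_lim/funext => n /=; rewrite /series/= -sumEFin.
Qed.

Lemma pois_pgf m q : 0 <= m -> 0 <= q ->
  (\sum_(k <oo) (q ^+ k * pois m k)%:E = (expR (- (m * (1 - q))))%:E)%E.
Proof.
move=> m0 q0.
transitivity (\sum_(k <oo) (expR (- m))%:E * ((m * q) ^+ k / k`!%:R)%:E)%E.
  apply: eq_eseriesr => k _; rewrite -EFinM exprMn /pois; congr EFin; ring.
rewrite nneseriesZl ?exp_series ?mulr_ge0//; last first.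
  by move=> k _; rewrite lee_fin mulr_ge0 ?exprn_ge0 ?mulr_ge0// invr_ge0.
by rewrite -EFinM -expRD; congr (expR _)%:E; ring.
Qed.

Lemma pois_pgf_deriv m q : 0 <= m -> 0 <= q ->
  (\sum_(k <oo) (k%:R * q ^+ k.-1 * pois m k)%:E = (m * expR (- (m * (1 - q))))%:E)%E.
Proof.
move=> m0 q0.
have g0 k : (0 <= (k%:R * q ^+ k.-1 * pois m k)%:E)%E.
  by rewrite lee_fin !mulr_ge0 ?exprn_ge0 ?pois_ge0.
rewrite nneseries_recl// !mul0r add0e -(nneseries_addn 1)//=.
rewrite EFinM -pois_pgf// -nneseriesZl; last first.
  by move=> k _; rewrite lee_fin mulr_ge0 ?exprn_ge0 ?pois_ge0.
apply: eq_eseriesr => k _; rewrite addn1 -EFinM; congr EFin.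
rewrite /pois /= exprS factS natrM invfM.
have : (k.+1%:R : R) != 0 by rewrite pnatr_eq0.
move: (k.+1%:R : R) => a a0.
by rewrite -[RHS]mul1r -(divff a0); ring.
Qed.
End poisson_series.

(** * Counting the points of a configuration *)

Section squeeze.
Context {R : realType}.

(** Every limit argument below has this form: the error is explicit and linear in the mesh, and the
bounds on the two sides are values at opposite arguments of one function. *)
Lemma squeeze_inv (g : R -> R) (r : \bar R) : {for 0, continuous g} ->
  (forall N : nat, (0 < N)%N ->
    (g (- N.+1%:R^-1))%:E <= r /\ r <= (g N.+1%:R^-1)%:E)%E ->
  r = (g 0)%:E.
Proof.
move=> cg h.
have rfin : r \is a fin_num.
  rewrite fin_numElt; have [h1 h2] := h 1%N isT.
  by rewrite (lt_le_trans _ h1) ?ltNyr// (le_lt_trans h2) ?ltry.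
rewrite -(fineK rfin) in h *; move: (fine r) h => {rfin}r h; congr EFin.
have cinv : (N.+1%:R^-1 : R) @[N --> \oo] --> (0 : R) by exact: cvg_harmonic.
have c1 : g N.+1%:R^-1 @[N --> \oo] --> g 0 by apply: continuous_cvg.
have c2 : g (- N.+1%:R^-1) @[N --> \oo] --> g 0.
  by apply: continuous_cvg => //; rewrite -[X in _ --> X]oppr0; exact: cvgN.
apply/eqP; rewrite eq_le; apply/andP; split.
  apply: (ler_cvg_to (cvg_cst r) c1); near=> N.
  have N0 : (0 < N)%N by near: N; exact: nbhs_infty_gt.
  by have [_] := h N N0; rewrite lee_fin.
apply: (ler_cvg_to c2 (cvg_cst r)); near=> N.
have N0 : (0 < N)%N by near: N; exact: nbhs_infty_gt.
by have [] := h N N0; rewrite lee_fin.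
Unshelve. all: by end_near. Qed.
End squeeze.

Section counting.
Context {R : realType}.
Implicit Types (x : nat -> R * R) (S B : set (R * R)).

(** Local finiteness in S: only finitely many indices give a point of S. *)
Definition eventually_out x S M := forall j, (M <= j)%N -> ~ S (x j).

Lemma point_measureE x B : point_measure x B = (\sum_(i <oo) (\1_B (x i))%:E)%E.
Proof. by []. Qed.

Lemma point_measure_count x S B M : eventually_out x S M -> B `<=` S ->
  point_measure x B = ((\sum_(j < M) (x j \in B))%N%:R)%:E.
Proof.
move=> xM BS; rewrite point_measureE (nneseries_split 0%N M)//.
rewrite add0n eseries0 ?adde0; last first.
  move=> k Mk _; rewrite indicE memNset//= => /BS; exact: xM.
by rewrite big_mkord sumEFin natr_sum; apply: congr1; apply: eq_bigr => j _; rewrite indicE.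
Qed.

Lemma point_measure_nat x S k : point_measure x S = k%:R%:E ->
  exists M, eventually_out x S M.
Proof.
move=> Sk; apply: contrapT => h.
have io M : exists2 j, (M <= j)%N & S (x j).
  apply: contrapT => h'; apply: h; exists M => j Mj Sj; apply: h'; by exists j.
have big a : exists M, (a <= \sum_(j < M) (x j \in S))%N.
  elim: a => [|a [M aM]]; first by exists 0%N.
  have [j Mj Sj] := io M; exists j.+1; rewrite big_ord_recr/= mem_set// addn1 ltnS.
  apply: leq_trans aM _.
  rewrite -(big_mkord xpredT (fun j => (x j \in S) : nat)).
  rewrite -(big_mkord xpredT (fun j => (x j \in S) : nat)).
  by rewrite (@big_cat_nat _ _ _ M 0 j)//= leq_addr.
have [M kM] := big k.+1.
have : (((\sum_(j < M) (x j \in S))%N%:R)%:E <= k%:R%:E :> \bar R)%E.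
  rewrite -Sk point_measureE natr_sum -sumEFin.
  rewrite -(big_mkord xpredT (fun j => (x j \in S)%:R%:E)).
  by apply: nneseries_lim_ge => j _; rewrite lee_fin.
by rewrite lee_fin ler_nat leqNgt kM.
Qed.

(** When l takes values in 0, ..., n on S, the cells partition S. *)
Definition cell S (l : R * R -> nat) c : set (R * R) := [set y | S y /\ l y = c].

Lemma sum_cell S (l : R * R -> nat) n (F : nat -> R) y :
  (forall y, S y -> (l y <= n)%N) ->
  (y \in S)%:R * F (l y) = \sum_(c < n.+1) (y \in cell S l c)%:R * F c.
Proof.
move=> ln; case: (boolP (y \in S)) => [|]; rewrite ?notin_setE ?inE => Sy.
  have lyn : (l y < n.+1)%N by rewrite ltnS ln.
  rewrite (bigD1 (Ordinal lyn))//= mem_set// big1 ?addr0// => c cly.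
  rewrite memNset ?mul0r// => -[_ lyc]; case/eqP: cly; apply/val_inj => /=.
  by rewrite lyc.
by rewrite mul0r big1// => c _; rewrite memNset ?mul0r// => -[].
Qed.

Lemma prod_cell S (l : R * R -> nat) n (q : nat -> R) y :
  (forall y, S y -> (l y <= n)%N) ->
  (if y \in S then q (l y) else 1) = \prod_(c < n.+1) q c ^+ (y \in cell S l c).
Proof.
move=> ln; case: ifPn => [|]; rewrite ?notin_setE ?inE => Sy.
  have lyn : (l y < n.+1)%N by rewrite ltnS ln.
  rewrite (bigD1 (Ordinal lyn))//= mem_set// big1 ?mulr1 ?expr1// => c cly.
  rewrite memNset// => -[_ lyc]; case/eqP: cly; apply/val_inj => /=.
  by rewrite lyc.
by rewrite big1// => c _; rewrite memNset// => -[].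
Qed.

(** A sum over points of S of the value of b at the point times the values of q at all other points
depends only on the numbers cnt c of points in each cell: cnt c choices of a point with label c
leave cnt c - 1 factors q c and all the factors of the other labels. As the cells are disjoint,
this makes the expectation computable from the finite-dimensional laws. *)
Lemma label_sum x S (l : R * R -> nat) n (b q : nat -> R) M :
  (forall y, S y -> (l y <= n)%N) ->
  let cnt c := (\sum_(j < M) (x j \in cell S l c))%N in
  \sum_(i < M) (x i \in S)%:R * (b (l (x i)) *
     \prod_(j < M | j != i) (if x j \in S then q (l (x j)) else 1)) =
  \sum_(c < n.+1) b c * \prod_(c' < n.+1)
    (if c' == c then (cnt c')%:R * q c' ^+ (cnt c').-1 else q c' ^+ cnt c').
Proof.
move=> ln cnt.
pose G c := \prod_(c' < n.+1) q c' ^+ (cnt c' - (nat_of_ord c' == c)).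
transitivity (\sum_(i < M) (x i \in S)%:R * (b (l (x i)) * G (l (x i)))).
  apply: eq_bigr => i _; case: (boolP (x i \in S)) => [|]; last by rewrite !mul0r.
  rewrite inE => Sxi; congr (_ * (_ * _)).
  rewrite (eq_bigr (fun j : 'I_M => \prod_(c < n.+1) q c ^+ (x j \in cell S l c))); last first.
    by move=> j _; exact: prod_cell.
  rewrite exchange_big/=; apply: eq_bigr => c _; rewrite prodrXr; congr (_ ^+ _).
  rewrite /cnt [in RHS](bigD1 i)//= addnC.
  case: (boolP (x i \in cell S l c)) => [|]; rewrite ?notin_setE ?inE => Dc.
    by case: Dc => _ ->; rewrite eqxx addnK.
  have -> : (nat_of_ord c == l (x i)) = false.
    by apply/negP => /eqP cl; apply: Dc; split.
  by rewrite addn0 subn0.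
transitivity (\sum_(i < M) \sum_(c < n.+1) (x i \in cell S l c)%:R * (b c * G c)).
  by apply: eq_bigr => i _; rewrite (@sum_cell S l n (fun c => b c * G c)).
rewrite exchange_big/=; apply: eq_bigr => c _.
rewrite -mulr_suml -natr_sum mulrCA; congr (_ * _).
rewrite /G (bigD1 c)//= [RHS](bigD1 c)//= !eqxx subn1 mulrA. congr (_ * _).
apply: eq_bigr => c' cc'.
have e : (nat_of_ord c' == c) = false by exact: negbTE.
by rewrite e (negbTE cc') subn0.
Qed.

End counting.

(** * Counts of the Poisson process in bounded sets *)

Section truncn_meas.
Context {R : realType}.
Lemma measurable_truncn_eq (k : nat) : measurable [set y : R | Num.truncn y = k].
Proof.
apply: is_interval_measurable => a b /= ak bk z /andP[az zb].
by apply/eqP; rewrite eqn_leq -{1}bk -ak !le_truncn.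
Qed.
End truncn_meas.

Section counts.
Context d (T : measurableType d) (R : realType) (P : probability T R).
Variables (lambda : R) (X : nat -> {RV P >-> (R * R)%type}).
Hypothesis lambda_gt0 : 0 < lambda.
Hypothesis X_poisson : is_poisson_process lambda X.

Definition vol (B : set (R * R)) : R := fine (leb2 B).

Definition config (w : T) (i : nat) : R * R := X i w.

(** The truncation makes the number of points a natural number; almost surely nothing is lost, the
counting measure of a bounded set being finite. *)
Definition num_points (B : set (R * R)) (w : T) : nat :=
  Num.truncn (fine (point_measure (config w) B)).

Lemma measurable_count B : measurable B ->
  measurable_fun setT (fun w => point_measure (config w) B).
Proof.
move=> mB; apply: ge0_emeasurable_sum => // i _.
by apply/measurable_EFinP; apply: (measurableT_comp (measurable_indic _)).
Qed.

Lemma measurable_num_points B k : measurable B -> measurable [set w | num_points B w = k].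
Proof.
move=> mB; rewrite -[X in measurable X]setTI.
have := measurableT_comp (fine_measurable measurableT) (measurable_count mB).
by move=> /(_ measurableT _ (measurable_truncn_eq k)).
Qed.

Lemma sub_bounded_box m (B : set (R * R)) : B `<=` box m -> bounded_set B.
Proof.
move=> Bm; exists m%:R; split; first exact: num_real.
move=> M mM [a b] /Bm[/=]; rewrite !in_itv/= -!ler_norml => am bm.
by rewrite prod_normE/= ge_max !(le_trans _ (ltW mM)).
Qed.

Lemma vol_ge0 B : 0 <= vol B.
Proof. by rewrite fine_ge0. Qed.

Lemma leb2_vol m B : measurable B -> B `<=` box m -> leb2 B = (vol B)%:E.
Proof.
move=> mB Bm; rewrite fineK// ge0_fin_numE//.
apply: le_lt_trans (leb2_box_lty m).
by apply: le_measure; rewrite ?inE//; exact: measurable_box.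
Qed.

Lemma count_law n (B : 'I_n -> set (R * R)) (k : 'I_n -> nat) m :
  (forall j, measurable (B j)) -> (forall j, B j `<=` box m) -> trivIset setT B ->
  P [set w | forall j, point_measure (config w) (B j) = (k j)%:R%:E] =
  (\prod_(j < n) pois (lambda * vol (B j)) (k j))%:E.
Proof.
move=> mB Bm tB; have /= -> := X_poisson k mB (fun j => sub_bounded_box (Bm j)) tB.
rewrite -prodEFin; apply: eq_bigr => j _.
rewrite poisson_prob1 areaE// ?mulr_ge0 ?vol_ge0// ltW//.
Qed.

Definition locally_finite (w : T) :=
  forall m, exists M, eventually_out (config w) (@box R m) M.

(** The Poisson probabilities of the values of the counting measure of a box sum to 1, so that the
measure is almost surely finite. *)
Lemma ae_locally_finite : {ae P, forall w, locally_finite w}.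
Proof.
apply: ae_foralln => m.
pose F k := [set w | point_measure (config w) (box m) = k%:R%:E].
have mF k : measurable (F k).
  rewrite -[X in measurable X]setTI.
  exact: (measurable_count (measurable_box m) measurableT (emeasurable_set1 _)).
have PF k : P (F k) = (pois (lambda * vol (box m)) k)%:E.
  have := @count_law 1 (fun=> box m) (fun=> k) m (fun=> measurable_box m) (fun=> @subset_refl _
    (box m)).
  rewrite big_ord1 => <-; last by move=> i j _ _ _; rewrite !ord1.
  by congr (P _); apply/seteqP; split => [w Fw j//|w /(_ ord0)].
exists (~` (\bigcup_k F k)); split.
- by apply: measurableC; exact: bigcupT_measurable.
- have mU : measurable (\bigcup_k F k) by exact: bigcupT_measurable.
  transitivity (1 - P (\bigcup_k F k))%E; first exact: probability_setC.
  rewrite measure_bigcup//=; last first.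
    by move=> i j _ _ [w [/= Fi]]; rewrite /F/= Fi => -[/eqP]; rewrite eqr_nat => /eqP.
  have E1 : (\sum_(k <oo) P (F k) = 1)%E.
    transitivity (\sum_(k <oo) (1 ^+ k * pois (lambda * vol (box m)) k)%:E)%E.
      by apply: eq_eseriesr => k _; rewrite PF expr1n mul1r.
    by rewrite pois_pgf ?mulr_ge0 ?vol_ge0 ?ltW// subrr mulr0 oppr0 expR0.
  rewrite (_ : (\sum_(0 <= i <oo | i \in [set: nat]) P (F i) = 1)%E) ?subee//.
  by rewrite -E1; apply: eq_eseriesl => i; rewrite in_setT.
- move=> w; apply: contra_not => -[k _ Fk]; exact: (point_measure_nat Fk).
Qed.

Lemma num_points_finite w B m M : eventually_out (config w) (box m) M -> B `<=` box m ->
  num_points B w = (\sum_(j < M) (config w j \in B))%N.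
Proof. by move=> wM Bm; rewrite /num_points (point_measure_count wM Bm)/= natrK. Qed.

Lemma num_points_law n (B : 'I_n -> set (R * R)) (k : 'I_n -> nat) m :
  (forall j, measurable (B j)) -> (forall j, B j `<=` box m) -> trivIset setT B ->
  P [set w | forall j, num_points (B j) w = k j] =
  (\prod_(j < n) pois (lambda * vol (B j)) (k j))%:E.
Proof.
move=> mB Bm tB; rewrite -(@count_law n B k m)//.
have mE (F : 'I_n -> set T) : (forall j, measurable (F j)) -> measurable [set w | forall j, F j w].
  move=> mF; rewrite (_ : [set w | _] = \bigcap_(j in [set: 'I_n]) F j).
    by apply: fin_bigcap_measurable => [|j _]; [exact: finite_finset|exact: mF].
  by apply/seteqP; split => [w Kw j _|w Kw j]; [exact: Kw|exact: Kw j I].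
have mA : measurable [set w | forall j, num_points (B j) w = k j].
  by apply: (mE (fun j w => num_points (B j) w = k j)) => j; exact: measurable_num_points.
have mA' : measurable [set w | forall j, point_measure (config w) (B j) = (k j)%:R%:E].
  apply: (mE (fun j w => point_measure (config w) (B j) = (k j)%:R%:E)) => j.
  rewrite -[X in measurable X]setTI.
  exact: (measurable_count (mB j) measurableT (emeasurable_set1 _)).
rewrite -[X in P X = _]setIT -[X in _ = P X]setIT -!integral_indic//.
apply: ge0_ae_eq_integral => //.
- by apply/measurable_EFinP; exact: measurable_indic.
- by apply/measurable_EFinP; exact: measurable_indic.
apply: filterS ae_locally_finite => w /(_ m)[M wM] _; congr EFin; rewrite !indicE.
congr (_%:R); congr nat_of_bool; apply/idP/idP; rewrite !inE/= => h j.
  by rewrite (point_measure_count wM (Bm j)) -(num_points_finite wM (Bm j)) h.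
rewrite (num_points_finite wM (Bm j)); have := h j; rewrite (point_measure_count wM (Bm j)).
by move=> [] /eqP; rewrite eqr_nat => /eqP.
Qed.

End counts.

(** * Void weights of a Poisson process *)

Section campbell.
Context d (T : measurableType d) (R : realType) (P : probability T R).
Variables (lambda : R) (X : nat -> {RV P >-> (R * R)%type}).
Hypothesis lambda_gt0 : 0 < lambda.
Hypothesis X_poisson : is_poisson_process lambda X.
Notation num_points := (num_points X).
Notation config := (config X).

Section labels.
Variables (m : nat) (l : R * R -> nat) (n : nat).
Hypothesis mcell : forall c, measurable (cell (@box R m) l c).
Hypothesis ln : forall y, @box R m y -> (l y <= n)%N.
Notation cel := (cell (@box R m) l).

Lemma cell_sub c : cel c `<=` box m. Proof. by move=> y []. Qed.

(** The right-hand side of [label_sum], as a function of the realisation. *)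
Definition label_fun (b q : nat -> R) w : R := \sum_(c < n.+1) b c *
  \prod_(c' < n.+1) (if c' == c then (num_points (cel c') w)%:R * q c' ^+ (num_points (cel c') w).-1
                     else q c' ^+ num_points (cel c') w).

Lemma trivIset_cell : trivIset setT (fun c : 'I_n.+1 => cel c).
Proof. by move=> i j _ _ [y [[_ yi] [_ yj]]]; apply: val_inj; rewrite /= -yi -yj. Qed.

Lemma measurable_num_points_fun c (h : nat -> R) : measurable_fun setT (fun w =>
  h (num_points (cel c) w)).
Proof.
apply: (@measurable_natfun _ _ _ 1 (fun _ w => num_points (cel c) w) _ ord0) => _ k.
exact: measurable_num_points.
Qed.

(** Independence of the counts reduces the mean to one-dimensional sums: a label c' contributes
exp (- lambda |D_c'| (1 - q c')), and the label of the distinguished point an extra factor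
lambda |D_c|, where D_c denotes the cell with label c. *)
Lemma label_expectation (b q : nat -> R) :
  (forall c, 0 <= b c) -> (forall c, 0 <= q c) ->
  (\int[P]_w (label_fun b q w)%:E =
   (lambda * (\sum_(c < n.+1) vol (cel c) * b c) *
     expR (- lambda * \sum_(c < n.+1) vol (cel c) * (1 - q c)))%:E)%E.
Proof.
move=> b0 q0.
pose h (c j : 'I_n.+1) (k : nat) : R := if j == c then k%:R * q j ^+ k.-1 else q j ^+ k.
pose e (c : 'I_n.+1) : R := expR (- (lambda * vol (cel c) * (1 - q c))).
pose s (c j : 'I_n.+1) : R := if j == c then lambda * vol (cel j) * e j else e j.
have lv0 c : 0 <= lambda * vol (cel c) by rewrite mulr_ge0 ?vol_ge0// ltW.
have h0 c j k : 0 <= h c j k by rewrite /h; case: ifP => _; rewrite ?mulr_ge0 ?exprn_ge0.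
have Eh (c : 'I_n.+1) : (\int[P]_w (\prod_j h c j (num_points (cel j) w))%:E =
  (\prod_j s c j)%:E)%E.
  apply: (@expectation_prod _ _ _ P _ (fun j : 'I_n.+1 => num_points (cel j))
    (fun j => pois (lambda * vol (cel j)))) => //.
  - by move=> j k; exact: measurable_num_points.
  - by move=> j k; rewrite pois_ge0.
  - move=> k; apply: (num_points_law lambda_gt0 X_poisson k (m := m)) => //.
    by move=> j; exact: cell_sub.
    exact: trivIset_cell.
  - move=> j; rewrite /h /s; case: ifP => _.
    + by rewrite pois_pgf_deriv.
    + by rewrite pois_pgf.
rewrite /label_fun; under eq_integral do rewrite -sumEFin.
rewrite ge0_integral_sum//; last 2 first.
- move=> c; apply/measurable_EFinP; apply: measurable_funM => //.
  apply: measurable_prod => j _; exact: (measurable_num_points_fun j (h c j)).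
- by move=> c w _; rewrite lee_fin mulr_ge0//; apply: prodr_ge0 => j _; exact: (h0 c j).
rewrite mulr_sumr mulr_suml -sumEFin; apply: eq_bigr => c _.
under eq_integral do rewrite EFinM.
rewrite ge0_integralZl_EFin//; last 2 first.
- by move=> w _; rewrite lee_fin; apply: prodr_ge0 => j _; exact: (h0 c j).
- apply/measurable_EFinP; apply: measurable_prod => j _;
  exact: (measurable_num_points_fun j (h c j)).
rewrite Eh -EFinM; congr EFin.
rewrite (bigD1 c)//= {1}/s eqxx (eq_bigr e); last first.
  by move=> j /negbTE jc; rewrite /s jc.
have De : \prod_j e j = e c * \prod_(j | j != c) e j by rewrite (bigD1 c).
transitivity (b c * (lambda * vol (cel c) * \prod_j e j)); first by rewrite De; ring.
rewrite /e -expR_sum mulr_sumr.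
rewrite (_ : \sum_(i < n.+1) - (lambda * vol (cel i) * (1 - q i)) =
  \sum_(i < n.+1) - lambda * (vol (cel i) * (1 - q i))); first by ring.
by apply: eq_bigr => j _; ring.
Qed.

Lemma vol_sum (g : nat -> R) : (forall c, 0 <= g c) ->
  (\int[leb2]_(y in box m) (g (l y))%:E = (\sum_(c < n.+1) vol (cel c) * g c)%:E)%E.
Proof.
move=> g0; have mbox : measurable (@box R m) := measurable_box m.
transitivity (\int[leb2]_(y in box m) (\sum_(c < n.+1) (g c)%:E * (\1_(cel c) y)%:E))%E.
  apply: eq_integral => y yS; rewrite -[in LHS](mul1r (g (l y))).
  have := sum_cell g y ln; rewrite yS => ->; rewrite -sumEFin.
  by apply: eq_bigr => c _; rewrite -EFinM indicE mulrC.
rewrite ge0_integral_sum//; last 2 first.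
- by move=> c; apply: measurable_funeM; apply/measurable_EFinP; exact: measurable_indic.
- by move=> c y _; rewrite -EFinM lee_fin mulr_ge0.
rewrite -sumEFin; apply: eq_bigr => c _.
rewrite ge0_integralZl_EFin//; last by apply/measurable_EFinP; exact: measurable_indic.
rewrite integral_indic//.
rewrite setIidl/=; last exact: cell_sub.
by rewrite (leb2_vol (mcell c) (@cell_sub c)) -EFinM mulrC.
Qed.

End labels.

Section void.
Variables (m : nat) (f : R * R -> R) (phi : R) (B : set (R * R)) (rho : nat -> T -> R).
Hypothesis mf : measurable_fun setT f.
Hypothesis f01 : forall y, 0 <= f y <= 1.
Hypothesis f1 : forall y, ~ box m y -> f y = 1.
Hypothesis phiE : (\int[leb2]_(y in box m) (f y)%:E = phi%:E)%E.
Hypothesis mB : measurable B.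
Hypothesis Bm : B `<=` box m.
Hypothesis mrho : forall i, measurable_fun setT (rho i).
Hypothesis rho0 : forall i w, 0 <= rho i w.
Hypothesis rhoE : forall w M, eventually_out (config w) (box m) M -> forall i : 'I_M,
  rho i w = \prod_(j < M | j != i) f (config w j).

(* (N+1) f(y), rounded down, is at most N+1; adding N+2 for the points of B makes the label record
   the rounded value as its residue mod N+2 and membership in B as its quotient. *)
Let a (N : nat) : R := N.+1%:R.
Let l (N : nat) (y : R * R) : nat :=
  (Num.truncn (a N * f y) + (if y \in B then N.+2 else 0))%N.
Let b (N : nat) (c : nat) : R := (N.+2 <= c)%N%:R.
Let qm (N : nat) (c : nat) : R := (c %% N.+2)%:R / a N.
Let qp (N : nat) (c : nat) : R := (c %% N.+2).+1%:R / a N.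
Let n N := (N.+1 + N.+2)%N.

Let a_gt0 N : 0 < a N. Proof. by rewrite ltr0n. Qed.

Let tr_le N y : (Num.truncn (a N * f y) <= N.+1)%N.
Proof.
have /andP[f0 fle1] := f01 y.
rewrite -(ler_nat R); apply: le_trans (_ : a N * f y <= _).
  by have /andP[] := truncn_itv (mulr_ge0 (ltW (a_gt0 N)) f0).
by rewrite -[leRHS]mulr1 ler_wpM2l// ltW.
Qed.

Let l_le N y : box m y -> (l N y <= n N)%N.
Proof. by move=> _; rewrite /l /n leq_add// ?tr_le//; case: ifP. Qed.

Let l_mod N y : (l N y %% N.+2 = Num.truncn (a N * f y))%N.
Proof.
have lt : (Num.truncn (a N * f y) < N.+2)%N by rewrite ltnS tr_le.
by rewrite /l; case: ifP => _; rewrite ?modnDr ?addn0 modn_small.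
Qed.

Let b_l N y : b N (l N y) = (y \in B)%:R.
Proof.
rewrite /b /l; case: ifP => _; first by rewrite leq_addl.
by rewrite addn0 leqNgt ltnS tr_le.
Qed.

Let qm_f N y : qm N (l N y) <= f y.
Proof.
have /andP[f0 _] := f01 y.
rewrite /qm l_mod ler_pdivrMr// [leRHS]mulrC.
by have /andP[] := truncn_itv (mulr_ge0 (ltW (a_gt0 N)) f0).
Qed.

Let f_qp N y : f y <= qp N (l N y).
Proof.
have /andP[f0 _] := f01 y.
rewrite /qp l_mod ler_pdivlMr// [leLHS]mulrC.
by have /andP[_ /ltW] := truncn_itv (mulr_ge0 (ltW (a_gt0 N)) f0).
Qed.

Let mcell N c : measurable (cell (box m) (l N) c).
Proof.
have mt k : measurable [set y | Num.truncn (a N * f y) = k].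
  rewrite -[X in measurable X]setTI.
  have h : measurable_fun setT (fun y => a N * f y) by exact: measurable_funM.
  exact: (h measurableT _ (measurable_truncn_eq k)).
rewrite (_ : cell _ _ _ = box m `&`
   ((B `&` [set y | exists2 k, (k + N.+2 = c)%N & Num.truncn (a N * f y) = k]) `|`
    (~` B `&` [set y | Num.truncn (a N * f y) = c]))).
  apply: measurableI; first exact: measurable_box.
  apply: measurableU; apply: measurableI => //; last exact: measurableC.
  rewrite (_ : [set y | _] = \bigcup_(k in [set k | (k + N.+2 =
    c)%N]) [set y | Num.truncn (a N * f y) = k]).
    by apply: bigcup_measurable.
  by apply/seteqP; split => [y [k kc fk]|y [k kc fk]]; exists k.
rewrite /cell /l; apply/seteqP; split => y /=.
  move=> [my]; case: ifPn => [|]; rewrite ?notin_setE ?inE => By lc.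
    by split => //; left; split => //; exists (Num.truncn (a N * f y)).
  by split => //; right; split => //; rewrite -lc addn0.
move=> [my [[By [k kc fk]]|[By lc]]]; split => //.
  by rewrite mem_set// fk.
by rewrite memNset// addn0.
Qed.

Let qm0 N c : 0 <= qm N c. Proof. by rewrite divr_ge0// ltW. Qed.
Let qp0 N c : 0 <= qp N c. Proof. by rewrite divr_ge0// ltW. Qed.
Let b0 N c : 0 <= b N c. Proof. by rewrite /b. Qed.

Let V := vol (@box R m).

Let volB N : \sum_(c < (n N).+1) vol (cell (box m) (l N) c) * b N c = vol B.
Proof.
apply: EFin_inj; rewrite -(vol_sum (mcell N) (@l_le N) (b0 N)).
rewrite -(leb2_vol mB Bm).
transitivity (\int[leb2]_(y in box m) (\1_B y)%:E)%E.
  by apply: eq_integral => y _; rewrite b_l indicE.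
by rewrite integral_indic ?setIidl//; exact: measurable_box.
Qed.

Let volS N : \sum_(c < (n N).+1) vol (cell (box m) (l N) c) = V.
Proof.
apply: EFin_inj; rewrite /V -(leb2_vol (measurable_box m) (@subset_refl _ _)).
have := @vol_sum m (l N) (n N) (mcell N) (@l_le N) (fun=> 1) (fun=> ler01).
rewrite integral_cst; last exact: measurable_box.
rewrite mul1e => ->; congr EFin; by apply: eq_bigr => c _; rewrite mulr1.
Qed.

Let mgl N (g : nat -> R) : measurable_fun (box m) (fun y => (g (l N y))%:E).
Proof.
apply/measurable_EFinP => mS A mA.
rewrite (_ : _ `&` _ = \bigcup_(c in [set c | A (g c)]) cell (box m) (l N) c).
  by apply: bigcup_measurable => c _; exact: mcell.
by apply/seteqP; split => [y [my /= Ay]|y [c /= Ac [my yc]]]; [exists (l N y)|split => //=;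
  rewrite yc].
Qed.

Let vol_qm N : \sum_(c < (n N).+1) vol (cell (box m) (l N) c) * qm N c <= phi.
Proof.
rewrite -lee_fin -(vol_sum (mcell N) (@l_le N) (qm0 N)).
rewrite -phiE; apply: ge0_le_integral.
- exact: measurable_box.
- by move=> y _; rewrite lee_fin qm0.
- exact: mgl.
- by apply/measurable_EFinP; exact: measurable_funTS.
- by move=> y _; rewrite lee_fin qm_f.
Qed.

Let vol_qp N : phi <= \sum_(c < (n N).+1) vol (cell (box m) (l N) c) * qp N c.
Proof.
rewrite -lee_fin -(vol_sum (mcell N) (@l_le N) (qp0 N)).
rewrite -phiE; apply: ge0_le_integral.
- exact: measurable_box.
- by move=> y _; rewrite lee_fin; case/andP: (f01 y).
- by apply/measurable_EFinP; exact: measurable_funTS.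
- exact: mgl.
- by move=> y _; rewrite lee_fin f_qp.
Qed.

Let vol_qpE N : \sum_(c < (n N).+1) vol (cell (box m) (l N) c) * qp N c =
  \sum_(c < (n N).+1) vol (cell (box m) (l N) c) * qm N c + V / a N.
Proof.
rewrite -(volS N) mulr_suml -big_split/=; apply: eq_bigr => c _.
by rewrite /qp /qm -natr1; ring.
Qed.

Let vol1B N (q : nat -> R) : \sum_(c < (n N).+1) vol (cell (box m) (l N) c) * (1 - q c) =
  V - \sum_(c < (n N).+1) vol (cell (box m) (l N) c) * q c.
Proof.
by rewrite -(volS N) -sumrB; apply: eq_bigr => c _; rewrite mulrBr mulr1.
Qed.

Definition void_sum w : \bar R := (\sum_(i <oo) (\1_B (config w i) * rho i w)%:E)%E.

Let void_sumE w M : eventually_out (config w) (box m) M ->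
  void_sum w = (\sum_(i < M) (config w i \in box m)%:R * ((config w i \in B)%:R *
     \prod_(j < M | j != i) f (config w j)))%:E.
Proof.
move=> wM; rewrite /void_sum (nneseries_split 0%N M)//; last first.
  by move=> k _; rewrite lee_fin mulr_ge0.
rewrite add0n eseries0 ?adde0; last first.
  by move=> k Mk _; rewrite indicE memNset ?mul0r// => /Bm; exact: wM.
rewrite big_mkord sumEFin; congr EFin; apply: eq_bigr => i _.
rewrite (rhoE wM) indicE; case: (boolP (config w i \in B)) => [|]; last by rewrite !mul0r mulr0.
move=> Bi; have Si : box m (config w i) by apply: Bm; rewrite -inE.
by rewrite (mem_set Si) !mul1r.
Qed.

Let label_bounds N w : locally_finite X w ->
  ((label_fun m (l N) (n N) (b N) (qm N) w)%:E <= void_sum w)%E /\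
  (void_sum w <= (label_fun m (l N) (n N) (b N) (qp N) w)%:E)%E.
Proof.
move=> /(_ m)[M wM].
have labelE q : label_fun m (l N) (n N) (b N) q w =
   \sum_(i < M) (config w i \in box m)%:R * (b N (l N (config w i)) *
     \prod_(j < M | j != i) (if config w j \in box m then q (l N (config w j)) else 1)).
  rewrite (label_sum _ _ _ _ (@l_le N)).
  apply: eq_bigr => c _; congr (_ * _); apply: eq_bigr => c' _.
  by rewrite (num_points_finite wM (@cell_sub m (l N) c')).
rewrite !labelE (void_sumE wM) !lee_fin; split; apply: ler_sum => i _.
  rewrite ler_wpM2l// b_l ler_wpM2l// ler_prod// => j _.
  case: ifPn => [_|]; first by rewrite qm0 qm_f.
  by rewrite notin_setE => /f1 ->; rewrite ler01 lexx.
rewrite ler_wpM2l// b_l ler_wpM2l// ler_prod// => j _.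
have /andP[-> _] := f01 (config w j).
case: ifPn => [_|]; first by rewrite f_qp.
by rewrite notin_setE => /f1 ->; rewrite lexx.
Qed.

(** The expected number of points of B, weighted by the product of f over all other points: the
Campbell-Mecke formula followed by the generating functional exp (- lambda int (1 - f)). The
function f is bounded below and above by functions with the finitely many values k/(N+1); the
label records k and whether the point lies in B, so that [label_expectation] applies to both
bounds. The product is given as an abstract [rho], equal to it on locally finite configurations,
which is how it arises from [avoid_prob]. *)
Lemma campbell_void :
  (\sum_(i <oo) \int[P]_w (\1_B (config w i) * rho i w)%:E =
   (lambda * vol B * expR (- lambda * (V - phi)))%:E)%E.
Proof.
have mt i : measurable_fun setT (fun w => (\1_B (config w i) * rho i w)%:E).
  apply/measurable_EFinP; apply: measurable_funM => //.
  by apply: (measurableT_comp (measurable_indic _)).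
have mvs : measurable_fun setT void_sum.
  apply: ge0_emeasurable_sum => // i w _ _; by rewrite lee_fin mulr_ge0.
have vs0 w : (0 <= void_sum w)%E.
  by apply: nneseries_ge0 => i _ _; rewrite lee_fin mulr_ge0.
rewrite -integral_nneseries//; last by move=> i w _; rewrite lee_fin mulr_ge0.
rewrite -/void_sum.
have mlab N q : measurable_fun setT (fun w => (label_fun m (l N) (n N) (b N) q w)%:E).
  apply/measurable_EFinP; apply: measurable_sum => c; apply: measurable_funM => //.
  apply: measurable_prod => c' _.
  exact: (@measurable_num_points_fun m (l N) (mcell N) c' (fun k =>
    if c' == c then k%:R * q c' ^+ k.-1 else q c' ^+ k)).
have lab0 N q w : (forall c, 0 <= q c) -> (0 <= (label_fun m (l N) (n N) (b N) q w)%:E)%E.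
  move=> q0; rewrite lee_fin sumr_ge0// => c _; rewrite mulr_ge0// prodr_ge0// => c' _.
  by case: ifP => _; rewrite ?mulr_ge0// exprn_ge0.
pose g e := lambda * vol B * expR (- lambda * (V - phi - e * V)).
rewrite (@squeeze_inv _ g (\int[P]_w void_sum w)%E).
- by rewrite /g mul0r subr0.
- rewrite /continuous_at; apply: cvgM; first exact: cvg_cst.
  apply: continuous_comp; last exact: continuous_expR.
  apply: cvgM; first exact: cvg_cst.
  apply: cvgB; first exact: cvg_cst.
  by apply: cvgM; [exact: cvg_id|exact: cvg_cst].
move=> N _; split.
- apply: (@le_trans _ _ (\int[P]_w (label_fun m (l N) (n N) (b N) (qm N) w)%:E)%E).
    rewrite label_expectation// volB vol1B lee_fin ler_wpM2l//.
      by rewrite mulr_ge0 ?vol_ge0// ltW.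
    rewrite ler_expR !mulNr lerN2 ler_wpM2l ?(ltW lambda_gt0)//.
    have := vol_qp N; rewrite vol_qpE /a; set s := \sum_(c < _) _.
    by rewrite [V / _]mulrC opprK; set t := _ * V; lra.
  apply: ae_ge0_le_integral => //.
  + by move=> w _; exact: lab0.
  + apply: filterS (ae_locally_finite lambda_gt0 X_poisson) => w /label_bounds h _.
    by case: (h N).
- apply: (@le_trans _ _ (\int[P]_w (label_fun m (l N) (n N) (b N) (qp N) w)%:E)%E).
    apply: ae_ge0_le_integral => //.
    + by move=> w _; exact: lab0.
    + apply: filterS (ae_locally_finite lambda_gt0 X_poisson) => w /label_bounds h _.
      by case: (h N).
  rewrite label_expectation// volB vol1B lee_fin ler_wpM2l//.
    by rewrite mulr_ge0 ?vol_ge0// ltW.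
  rewrite ler_expR !mulNr lerN2 ler_wpM2l ?(ltW lambda_gt0)//.
  have := vol_qm N; rewrite vol_qpE /a; set s := \sum_(c < _) _.
  by rewrite [V / _]mulrC; set t := _ * V; lra.
Qed.
End void.

End campbell.

(** * Independence of two families as a Fubini formula *)

Section independent_fubini.
Context d (T : measurableType d) (R : realType) (P : probability T R).
Context d1 (T1 : measurableType d1) d2 (T2 : measurableType d2).
Variables (f1 : {mfun T >-> T1}) (f2 : {mfun T >-> T2}).
Hypothesis f12 : forall A B, measurable A -> measurable B ->
  (P (f1 @^-1` A `&` f2 @^-1` B) = P (f1 @^-1` A) * P (f2 @^-1` B))%E.

(** The joint law of two independent variables is the product of the laws: this is Tonelli for the
product measure, read on T. *)
Lemma ge0_integral_independent (k : T1 * T2 -> \bar R) :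
  measurable_fun setT k -> (forall z, 0 <= k z)%E ->
  (\int[P]_w k (f1 w, f2 w) = \int[P]_w1 \int[P]_w2 k (f1 w1, f2 w2))%E.
Proof.
move=> mk k0.
have mf : measurable_fun setT (fun w => (f1 w, f2 w)).
  by apply: measurable_fun_pair.
pose f : {mfun T >-> (T1 * T2)%type} :=
  HB.pack (fun w => (f1 w, f2 w)) (isMeasurableFun.Build _ _ _ _ _ mf).
pose m1 := distribution P f1; pose m2 := distribution P f2.
have mE A : measurable A -> (m1 \x m2)%E A = distribution P f A.
  move=> mA; apply: (@product_measure_unique _ _ T1 T2 R m1 m2 (distribution P f)) => //.
rewrite -[LHS](ge0_integral_pushforward mf P (D := setT))//.
rewrite (eq_measure_integral (m1 \x m2)%E); last first.
  by move=> A mA _; exact/esym/mE.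
rewrite fubini_tonelli1//.
have mF := @measurable_fun_fubini_tonelli_F _ _ _ _ _ m2 _ mk k0.
rewrite (@ge0_integral_pushforward _ _ _ _ _ f1 _ P setT (fubini_F m2 k))//; last 1 first.
- by move=> x _; apply: integral_ge0 => y _; exact: k0.
apply: eq_integral => w1 _; rewrite /fubini_F/=.
rewrite (@ge0_integral_pushforward _ _ _ _ _ f2 _ P setT (fun y => k (f1 w1, y)))//.
exact: measurableT_comp mk _.
Qed.

End independent_fubini.

Section families.
Context d (T : measurableType d) (R : realType) (P : probability T R).
Context d1 (E1 : measurableType d1) d2 (E2 : measurableType d2).
Variables (X : nat -> {RV P >-> E1}) (Theta : nat -> {RV P >-> E2}).
Hypothesis XT : independent_families X Theta.

Definition pre_system d' (E : measurableType d') (Y : nat -> {RV P >-> E}) :=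
  \bigcup_(i in [set: nat]) preimage_set_system setT (Y i) measurable.

(** The underlying set T with the sigma-algebra generated by the family: the identity map from T to
this space plays the role of the whole infinite sequence, so that no product of infinitely many
spaces is needed. *)
Definition space d' (E : measurableType d') (Y : nat -> {RV P >-> E}) :=
  g_sigma_algebraType (pre_system Y).

Lemma measurable_to_space d' (E : measurableType d') (Y : nat -> {RV P >-> E}) :
  measurable_fun setT (fun w : T => w : space Y).
Proof.
move=> _ A mA; rewrite setTI; apply: smallest_sub mA.
  split; first exact: measurable0.
    by move=> B mB; rewrite setTD; exact: measurableC.
  by move=> F mF; exact: bigcupT_measurable.
move=> B [i _ [C mC <-]]; exact: (measurable_funPT (Y i)).
Qed.

Lemma measurable_from_space d' (E : measurableType d') (Y : nat -> {RV P >-> E}) i :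
  measurable_fun setT (fun w : space Y => Y i w).
Proof.
by move=> _ C mC; apply: sub_sigma_algebra; exists i => //; exists C.
Qed.

(** Positions and angles may be integrated separately: under the identity maps to the two generated
spaces, independence of the families is independence of two variables. *)
Lemma ge0_integral_families (k : T -> T -> \bar R) :
  measurable_fun setT (fun z : space X * space Theta => k z.1 z.2) ->
  (forall w1 w2, 0 <= k w1 w2)%E ->
  (\int[P]_w k w w = \int[P]_w1 \int[P]_w2 k w1 w2)%E.
Proof.
move=> mk k0.
pose f1 : {mfun T >-> space X} :=
  HB.pack (fun w : T => w : space X) (isMeasurableFun.Build _ _ _ _ _ (@measurable_to_space _ _ X)).
pose f2 : {mfun T >-> space Theta} :=
  HB.pack (fun w : T => w : space Theta) (isMeasurableFun.Build _ _ _ _ _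
    (@measurable_to_space _ _ Theta)).
have f12 A B : measurable A -> measurable B ->
  (P (f1 @^-1` A `&` f2 @^-1` B) = P (f1 @^-1` A) * P (f2 @^-1` B))%E.
  by move=> mA mB; exact: XT.
exact: (@ge0_integral_independent _ _ _ _ _ _ _ _ f1 f2 f12 (fun z => k z.1 z.2) mk (fun z =>
  k0 z.1 z.2)).
Qed.

Lemma measurable_fun_families (k : T -> T -> \bar R) :
  measurable_fun setT (fun z : space X * space Theta => k z.1 z.2) ->
  (forall w1 w2, 0 <= k w1 w2)%E ->
  measurable_fun setT (fun w1 : T => \int[P]_w2 k w1 w2)%E.
Proof.
move=> mk k0.
pose f2 : {mfun T >-> space Theta} :=
  HB.pack (fun w : T => w : space Theta) (isMeasurableFun.Build _ _ _ _ _
    (@measurable_to_space _ _ Theta)).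
have mF := @measurable_fun_fubini_tonelli_F _ _ _ _ _ (distribution P f2) _ mk (fun z =>
  k0 z.1 z.2).
apply: (eq_measurable_fun (fubini_F (distribution P f2) (fun z : space X * space Theta =>
  k z.1 z.2) \o (fun w : T => w : space X))).
  move=> w1 _; rewrite /fubini_F/=.
  rewrite (@ge0_integral_pushforward _ _ _ _ _ f2 _ P setT (fun y => k w1 y))//.
  have : measurable_fun setT ((fun z : space X * space Theta =>
    k z.1 z.2) \o (@pair (space X) (space Theta) w1)).
    by apply: measurableT_comp.
  by [].
exact: (measurableT_comp mF (@measurable_to_space _ _ X)).
Qed.

End families.

(** * The marked process at a fixed time *)

Section displaced.
Context {R : realType}.
Variables (s r : R).

(** Marks of the stations that a displacement of length s in their own direction brings to distance
less than r from the origin. At time t the displacement is s = v * t. *)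
Definition hit : set ((R * R) * R) :=
  [set z | (z.1.1 + s * cos z.2) ^+ 2 + (z.1.2 + s * sin z.2) ^+ 2 < r ^+ 2].

Lemma measurable_hit : measurable hit.
Proof.
have mc : measurable_fun setT (fun z : (R * R) * R => cos z.2).
  by apply: measurableT_comp => //; exact: continuous_measurable_fun (@continuous_cos R).
have ms : measurable_fun setT (fun z : (R * R) * R => sin z.2).
  by apply: measurableT_comp => //; exact: continuous_measurable_fun (@continuous_sin R).
have m11 : measurable_fun setT (fun z : (R * R) * R => z.1.1) by apply: measurableT_comp.
have m12 : measurable_fun setT (fun z : (R * R) * R => z.1.2) by apply: measurableT_comp.
have mh : measurable_fun setT (fun z : (R * R) * R =>
    (z.1.1 + s * cos z.2) ^+ 2 + (z.1.2 + s * sin z.2) ^+ 2).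
  by apply: measurable_funD; apply: measurable_funX; apply: measurable_funD => //;
    apply: measurable_funM.
have := mh measurableT _ (measurable_itv `]-oo, (r ^+ 2)[); rewrite setTI.
by congr measurable; apply/seteqP; split => z; rewrite /hit/= in_itv.
Qed.

Lemma hit_box m y a : 0 <= r -> r + `|s| <= m%:R -> hit (y, a) -> box m y.
Proof.
move=> r0 rm; rewrite /hit/= => h.
have aux x c : `|c| <= 1 -> (x + s * c) ^+ 2 < r ^+ 2 -> `|x| <= m%:R.
  move=> c1 xr; have xr' : `|x + s * c| < r.
    by rewrite -(ltr_pXn2r (ltn0Sn 1)) ?nnegrE// real_normK ?num_real.
  rewrite -(addrK (s * c) x); apply: le_trans (ler_normB _ _) _.
  apply: le_trans rm; rewrite lerD// ?(ltW xr')// normrM.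
  by rewrite ler_piMr.
split; rewrite /= in_itv/= -ler_norml; apply: aux.
- exact: cos_max.
- by apply: le_lt_trans h; rewrite lerDl sqr_ge0.
- exact: sin_max.
- by apply: le_lt_trans h; rewrite lerDr sqr_ge0.
Qed.

(** For a fixed angle the set is a disc of radius r translated by a vector. *)
Lemma leb2_hit a : 0 <= r -> leb2 (ysection hit a) = (pi * r ^+ 2)%:E.
Proof.
move=> r0; rewrite -(leb2_disc r0).
set D := [set z | _].
have mD : measurable D.
  have mh : measurable_fun setT (fun z : R * R => z.1 ^+ 2 + z.2 ^+ 2).
    by apply: measurable_funD; apply: measurable_funX.
  have := mh measurableT _ (measurable_itv `]-oo, (r ^+ 2)[); rewrite setTI.
  by congr measurable; apply/seteqP; split => z; rewrite /D/= in_itv.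
have mH : measurable (ysection hit a) by apply: measurable_ysection; exact: measurable_hit.
have h := @ge0_integral_leb2_translation R (s * cos a, s * sin a) (fun z => (\1_D z)%:E).
have I (A : set (R * R)) : measurable A -> (leb2 A = \int[leb2]_z (\1_A z)%:E)%E.
  by move=> mA; rewrite integral_indic// setIT.
rewrite (I _ mD) (I _ mH) -h; last 2 first.
- by apply/measurable_EFinP; exact: measurable_indic.
- by move=> z; rewrite lee_fin.
apply: eq_integral => z _; rewrite !indicE; congr (_ %:R)%:E; congr nat_of_bool.
by rewrite /ysection /hit /D; apply/idP/idP; rewrite !inE/= ?inE.
Qed.

End displaced.

Section marked.
Context d (T : measurableType d) (R : realType) (P : probability T R).
Variables (lambda : R) (X : nat -> {RV P >-> (R * R)%type}) (Theta : nat -> {RV P >-> R}).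
Hypothesis lambda_gt0 : 0 < lambda.
Hypothesis X_poisson : is_poisson_process lambda X.
Hypothesis Theta_indep : mutually_independent Theta.
Variable U : probability R R.
Hypothesis Theta_law : forall i B, measurable B -> P (Theta i @^-1` B) = U B.
Variables (s r : R).
Hypothesis r_ge0 : 0 <= r.
Notation hit := (@hit R s r).
Notation config := (config X).

Definition avoid i (w1 w2 : T) := forall j, j <> i -> ~ hit (X j w1, Theta j w2).

(** The probability that a station starting at y escapes the disc: the thinning function to which
[campbell_void] is applied. *)
Definition miss (y : R * R) : R := fine (U (~` xsection hit y)).

Lemma miss01 y : 0 <= miss y <= 1.
Proof.
have mH : measurable (~` xsection hit y).
  by apply: measurableC; apply: measurable_xsection; exact: measurable_hit.
rewrite /miss fine_ge0//= -lee_fin fineK ?probability_le1//.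
exact: fin_num_measure.
Qed.

Lemma miss_out m y : r + `|s| <= m%:R -> ~ box m y -> miss y = 1.
Proof.
move=> rm my; rewrite /miss (_ : xsection hit y = set0) ?setC0 ?probability_setT//.
by rewrite -subset0 => a; rewrite /xsection/= inE => /(hit_box r_ge0 rm)/my.
Qed.

Lemma missE y : U (~` xsection hit y) = (miss y)%:E.
Proof.
rewrite fineK//; apply: fin_num_measure.
by apply: measurableC; apply: measurable_xsection; exact: measurable_hit.
Qed.

Lemma measurable_miss : measurable_fun setT miss.
Proof.
have mH : measurable (~` hit) by apply: measurableC; exact: measurable_hit.
have := measurable_fun_xsection U mH.
move=> /(measurableT_comp (fine_measurable measurableT)).
apply: eq_measurable_fun => y _ /=; congr (fine (U _)).
by apply/seteqP; split => a; rewrite /xsection/= !inE /= ?inE.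
Qed.

(** Only the stations starting in a large box can reach the disc, so that the condition involves
finitely many independent angles. *)
Lemma avoid_prob m M i w1 C : r + `|s| <= m%:R ->
  eventually_out (config w1) (box m) M -> (i < M)%N -> measurable C ->
  (P [set w2 | C (Theta i w2) /\ avoid i w1 w2] =
   U C * (\prod_(j < M | nat_of_ord j != i) miss (config w1 j))%:E)%E.
Proof.
move=> rm wM iM mC.
pose Bs j := if j == i then C else ~` xsection hit (config w1 j).
have mBs j : measurable (Bs j).
  rewrite /Bs; case: ifP => // _.
  by apply: measurableC; apply: measurable_xsection; exact: measurable_hit.
rewrite (_ : [set w2 | _] = \bigcap_(j in [set` fset_set `I_M]) (Theta j @^-1` Bs j)).
  rewrite Theta_indep// fset_set_II big_imfset/=; last by move=> ? ? _ _ /val_inj.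
  rewrite big_enum/= (bigD1 (Ordinal iM))//=.
  rewrite Theta_law// {1}/Bs eqxx; congr (_ * _)%E.
  rewrite -prodEFin; apply: eq_big => j //= ji.
  by rewrite Theta_law// /Bs ifN// missE.
apply/seteqP; split => [w2 [Cw av] j|w2 h].
  rewrite /= in_fset_set// inE/= => jM; rewrite /Bs; case: eqP => [->//|ji].
  by move=> /=; rewrite /xsection/= inE; exact: av.
have h' j : (j < M)%N -> Bs j (Theta j w2).
  by move=> jM; apply: h; rewrite /= in_fset_set// inE.
split; first by have := h' _ iM; rewrite /Bs eqxx.
move=> j ji; have [jM|Mj] := ltnP j M.
  have := h' _ jM; rewrite /Bs; case: eqP => // _; rewrite /xsection/=.
  by apply: contra_not => ?; rewrite inE.
by move=> /(hit_box r_ge0 rm); exact: wM.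
Qed.

Hypothesis XT : independent_families X Theta.

(** By Tonelli, int (1 - miss) is the mean area over the angle of a disc of radius r: displacing the
points leaves the intensity unchanged. *)
Lemma miss_integral m : r + `|s| <= m%:R ->
  (\int[leb2]_(y in box m) (miss y)%:E = (vol (@box R m) - pi * r ^+ 2)%:E)%E.
Proof.
move=> rm.
have mbox := @measurable_box R m.
have mH := measurable_hit s r.
have tot : (\int[leb2]_(y in box m) (1 - miss y)%:E = (pi * r ^+ 2)%:E)%E.
  rewrite integral_mkcond.
  transitivity (\int[leb2]_y U (xsection hit y))%E.
    apply: eq_integral => y _; rewrite patchE.
    have -> : U (xsection hit y) = (1 - miss y)%:E.
      rewrite EFinB -missE -probability_setC ?setCK//.
      by apply: measurableC; exact: measurable_xsection.
    by case: ifPn => //; rewrite notin_setE => /(miss_out rm) ->; rewrite subrr.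
  transitivity ((leb2 \x U) hit)%E => //.
  transitivity ((leb2 \x^ U) hit)%E.
    by apply: product_measure_unique => // A B mA mB; exact: product_measure2E.
  transitivity (\int[U]_a (cst (pi * r ^+ 2)%:E a))%E.
    by apply: eq_integral => a _; exact: leb2_hit.
  by rewrite integral_cst// [X in (_ * X)%E](probability_setT U) mule1.
have mm := measurable_miss.
have : (\int[leb2]_(y in box m) ((miss y)%:E + (1 - miss y)%:E) = (vol (@box R m))%:E)%E.
  rewrite -(leb2_vol mbox (@subset_refl _ _)).
  transitivity (\int[leb2]_(y in box m) (cst (1%:E : \bar R) y))%E.
    by apply: eq_integral => y _; rewrite -EFinD subrKC.
  by rewrite integral_cst// mul1e.
rewrite ge0_integralD//; last 4 first.
- by move=> y _; rewrite lee_fin; case/andP: (miss01 y).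
- by apply/measurable_EFinP; exact: measurable_funTS.
- by move=> y _; rewrite lee_fin subr_ge0; case/andP: (miss01 y).
- by apply/measurable_EFinP; apply: measurable_funTS; exact: measurable_funB.
rewrite tot => h; rewrite EFinB -h addeK//.
Qed.

Lemma measurable_avoid i :
  measurable [set z : space X * space Theta | avoid i z.1 z.2].
Proof.
rewrite (_ : [set z | _] = \bigcap_(j in [set j | j <> i])
   ~` ((fun z : space X * space Theta => (X j z.1, Theta j z.2)) @^-1` hit)).
  apply: bigcap_measurableType => j _; apply: measurableC.
  rewrite -[X in measurable X]setTI.
  have mj : measurable_fun setT (fun z : space X * space Theta => (X j z.1, Theta j z.2)).
    apply: measurable_fun_pair.
      exact: (measurableT_comp (@measurable_from_space _ _ _ P _ _ X j) measurable_fst).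
    exact: (measurableT_comp (@measurable_from_space _ _ _ P _ _ Theta j) measurable_snd).
  exact: (mj measurableT _ (measurable_hit s r)).
by apply/seteqP; split => z h j /h.
Qed.

Lemma measurable_avoid_diag i : measurable [set w | avoid i w w].
Proof.
have md : measurable_fun setT (fun w : T => ((w, w) : space X * space Theta)).
  apply: measurable_fun_pair; exact: measurable_to_space.
by have := md measurableT _ (measurable_avoid i); rewrite setTI.
Qed.

Lemma measurable_avoid2 i w1 : measurable [set w2 | avoid i w1 w2].
Proof.
have md : measurable_fun setT (fun w : T => ((w1, w) : space X * space Theta)).
  apply: measurable_fun_pair => //; exact: measurable_to_space.
by have := md measurableT _ (measurable_avoid i); rewrite setTI.
Qed.

Definition void_prob i w1 : R := fine (P [set w2 | avoid i w1 w2]).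

Lemma void_probE i w1 : (P [set w2 | avoid i w1 w2] = (void_prob i w1)%:E)%E.
Proof. by rewrite fineK// fin_num_measure//; exact: measurable_avoid2. Qed.

Let kav i (B : set (R * R)) (C : set R) w1 w2 : \bar R :=
  (\1_B (X i w1) * (\1_C (Theta i w2) * \1_[set w | avoid i w1 w] w2))%:E.

Let mkav i B C : measurable B -> measurable C ->
  measurable_fun setT (fun z : space X * space Theta => kav i B C z.1 z.2).
Proof.
move=> mB mC; apply/measurable_EFinP; apply: measurable_funM.
  apply: (measurableT_comp (measurable_indic mB)).
  exact: (measurableT_comp (@measurable_from_space _ _ _ P _ _ X i) measurable_fst).
apply: measurable_funM.
  apply: (measurableT_comp (measurable_indic mC)).
  exact: (measurableT_comp (@measurable_from_space _ _ _ P _ _ Theta i) measurable_snd).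
apply: (eq_measurable_fun (\1_[set z : space X * space Theta | avoid i z.1 z.2] : _ -> R)).
  by move=> z _; rewrite !indicE; congr (_%:R); congr nat_of_bool; apply/idP/idP; rewrite !inE.
by apply: measurable_indic; exact: measurable_avoid.
Qed.

Let kav0 i B C w1 w2 : (0 <= kav i B C w1 w2)%E.
Proof. by rewrite lee_fin !mulr_ge0. Qed.

Lemma measurable_void_prob i : measurable_fun setT (void_prob i).
Proof.
have := measurable_fun_families (@mkav i setT setT measurableT measurableT) (@kav0 i setT setT).
move=> /(measurableT_comp (fine_measurable measurableT)).
apply: eq_measurable_fun => w1 _ /=; rewrite /void_prob; congr fine.
rewrite -[X in _ = P X]setIT -integral_indic//; last exact: measurable_avoid2.
by apply: eq_integral => w2 _; rewrite /kav !indicT !mul1r.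
Qed.

(** Integrating over the angles first factors out U C, since the angle of station i is independent
of the others ([avoid_prob]); the remaining sum over positions is given by [campbell_void]. *)
Lemma marked_campbell_rect m (B : set (R * R)) (C : set R) : r + `|s| <= m%:R ->
  measurable B -> B `<=` box m -> measurable C ->
  (\sum_(i <oo) P [set w | [/\ B (X i w), C (Theta i w) & avoid i w w]] =
   (lambda * expR (- lambda * (pi * r ^+ 2)))%:E * (leb2 B * U C))%E.
Proof.
move=> rm mB Bm mC.
have Ufin : U C \is a fin_num by exact: fin_num_measure.
transitivity (\sum_(i <oo) (U C * \int[P]_w (\1_B (config w i) * void_prob i w)%:E))%E.
  apply: eq_eseriesr => i _.
  have mE : measurable [set w | [/\ B (X i w), C (Theta i w) & avoid i w w]].
    rewrite (_ : [set w | _] = (X i @^-1` B) `&` ((Theta i @^-1` C) `&` [set w | avoid i w w])).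
      apply: measurableI; last apply: measurableI.
      - by rewrite -[X in measurable X]setTI; exact: measurable_funPT.
      - by rewrite -[X in measurable X]setTI; exact: measurable_funPT.
      - exact: measurable_avoid_diag.
    by apply/seteqP; split => w /=; [move=> [? ? ?]|move=> [? [? ?]]].
  rewrite -[X in P X]setIT -integral_indic//.
  transitivity (\int[P]_w kav i B C w w)%E.
    apply: eq_integral => w _; rewrite /kav !indicE -!natrM !mulnb; congr (_%:R)%:E.
    congr nat_of_bool; apply/idP/idP.
      by rewrite inE/= => -[? ? ?]; apply/and3P; split; rewrite inE.
    by move=> /and3P[]; rewrite !inE/=.
  rewrite (ge0_integral_families XT (mkav i mB mC) (@kav0 i B C)).
  rewrite -ge0_integralZl//; last 2 first.
  - apply/measurable_EFinP; apply: measurable_funM; last exact: measurable_void_prob.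
    by apply: (measurableT_comp (measurable_indic mB)).
  - by move=> w _; rewrite lee_fin mulr_ge0// fine_ge0.
  apply: ge0_ae_eq_integral => //.
  - exact: (measurable_fun_families (mkav i mB mC) (@kav0 i B C)).
  - apply: emeasurable_funM => //; apply/measurable_EFinP; apply: measurable_funM.
      by apply: (measurableT_comp (measurable_indic mB)).
    exact: measurable_void_prob.
  - by move=> w _; exact: integral_ge0.
  - by move=> w _; rewrite mule_ge0// lee_fin mulr_ge0// fine_ge0.
  apply: filterS (ae_locally_finite lambda_gt0 X_poisson) => w1 /(_ m)[M wM] _.
  pose M' := maxn M i.+1.
  have wM' : eventually_out (config w1) (box m) M'.
    by move=> j; rewrite geq_max => /andP[Mj _]; exact: wM.
  have iM : (i < M')%N by rewrite leq_max ltnSn orbT.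
  transitivity ((\1_B (config w1 i))%:E * P [set w2 | C (Theta i w2) /\ avoid i w1 w2])%E.
    have mCa : measurable [set w2 | C (Theta i w2) /\ avoid i w1 w2].
      rewrite (_ : [set w2 | _] = (Theta i @^-1` C) `&` [set w2 | avoid i w1 w2])//.
      apply: measurableI; last exact: measurable_avoid2.
      by rewrite -[X in measurable X]setTI; exact: measurable_funPT.
    rewrite -[X in P X]setIT -integral_indic//.
    rewrite -ge0_integralZl_EFin//; last by apply/measurable_EFinP; exact: measurable_indic.
    apply: eq_integral => w2 _; rewrite /kav -EFinM !indicE -natrM mulnb; congr (_ * _%:R)%:E.
    congr nat_of_bool; apply/idP/idP.
      by move=> /andP[]; rewrite !inE/= => ? ?.
    by rewrite inE/= => -[? ?]; rewrite mem_set//= mem_set.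
  rewrite (avoid_prob rm wM' iM mC) EFinM muleCA; congr (_ * (_ * _))%E.
  rewrite -void_probE (_ : [set w2 | avoid i w1 w2] =
    [set w2 | setT (Theta i w2) /\ avoid i w1 w2]).
    by rewrite (avoid_prob rm wM' iM measurableT) probability_setT mul1e.
  by apply/seteqP; split => w2 //= [].
rewrite -(fineK Ufin) nneseriesZl; last by move=> i _; apply: integral_ge0 => w _;
  rewrite lee_fin mulr_ge0// fine_ge0.
rewrite (campbell_void lambda_gt0 X_poisson measurable_miss miss01 (fun y => @miss_out m y rm)
  (miss_integral rm) mB Bm measurable_void_prob).
- rewrite (leb2_vol mB Bm) -!EFinM; congr EFin.
  by rewrite subKr; ring.
- by move=> i w; rewrite fine_ge0.
move=> w M wM i; apply: EFin_inj; rewrite -void_probE.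
rewrite (_ : [set w2 | avoid i w w2] = [set w2 | setT (Theta i w2) /\ avoid i w w2]).
  by rewrite (avoid_prob rm wM (ltn_ord i) measurableT) probability_setT mul1e.
by apply/seteqP; split => w2 //= [].
Qed.

End marked.

Section restriction.
Context d (T : measurableType d) (R : realType) (mu : {measure set T -> \bar R}).
Variables (D : set T) (mD : measurable D).

Lemma ge0_integral_mrestr (f : T -> \bar R) : measurable_fun setT f ->
  (forall x, 0 <= f x)%E ->
  (\int[mrestr mu mD]_x f x = \int[mu]_(x in D) f x)%E.
Proof.
move=> mf f0.
have mN : measurable (~` D) by exact: measurableC.
have N0 : mrestr mu mD (~` D) = 0%E by rewrite /mrestr setICl measure0.
rewrite (ge0_negligible_integral mN measurableT mf (fun x _ => f0 x) N0).
rewrite setTD setCK; apply: eq_measure_integral => A mA AD.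
by rewrite /= /mrestr setIidl.
Qed.
End restriction.

Section marked_campbell.
Context d (T : measurableType d) (R : realType) (P : probability T R).
Variables (lambda : R) (X : nat -> {RV P >-> (R * R)%type}) (Theta : nat -> {RV P >-> R}).
Hypothesis lambda_gt0 : 0 < lambda.
Hypothesis X_poisson : is_poisson_process lambda X.
Hypothesis Theta_indep : mutually_independent Theta.
Variable U : probability R R.
Hypothesis Theta_law : forall i B, measurable B -> P (Theta i @^-1` B) = U B.
Hypothesis XT : independent_families X Theta.

Definition mark i (w : T) : (R * R) * R := (X i w, Theta i w).

Lemma measurable_mark i : measurable_fun setT (mark i).
Proof. by apply: measurable_fun_pair. Qed.

Variables (s r : R).
Hypothesis r_ge0 : 0 <= r.

Definition avoid_set i : set T := [set w | avoid X Theta s r i w w].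

Lemma measurable_avoid_set i : measurable (avoid_set i).
Proof. exact: (measurable_avoid_diag X Theta s r i). Qed.

Let Mi i : {measure set ((R * R) * R)%type -> \bar R} :=
  measure_function_pushforward__canonical__measure_function_Measure
    (mrestr P (measurable_avoid_set i)) (measurable_mark i).

Let c : R := lambda * expR (- lambda * (pi * r ^+ 2)).
Let c_ge0 : 0 <= c. Proof. by rewrite mulr_ge0// ltW. Qed.

Let M : {measure set ((R * R) * R)%type -> \bar R} := mseries Mi 0.
Let M' : {measure set ((R * R) * R)%type -> \bar R} := mscale (NngNum c_ge0) (leb2 \x U)%E.

Let box_mono m n : (m <= n)%N -> @box R m `<=` box n.
Proof.
move=> mn [x y] [/=]; rewrite !in_itv/= -!ler_norml => xm ym.
have mnR : (m%:R <= n%:R :> R) by rewrite ler_nat.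
by split; rewrite /= in_itv/= -ler_norml (le_trans _ mnR).
Qed.

Let bounded_rect (A : set ((R * R) * R)) := exists B C m,
  [/\ measurable B, B `<=` @box R m, measurable C & A = B `*` C].

Let M_rect A : bounded_rect A -> M A = M' A.
Proof.
move=> [B [C [m [mB Bm mC ->]]]].
pose n := (Num.truncn (r + `|s|)).+1.
have rn : r + `|s| <= (maxn m n)%:R.
  apply: le_trans (ltW (truncnS_gt _)) _.
  by rewrite ler_nat leq_max leqnn orbT.
rewrite /M' /= /mscale/= product_measure1E//=.
rewrite -(marked_campbell_rect lambda_gt0 X_poisson Theta_indep Theta_law r_ge0 XT rn)//;
  last first.
  by apply: subset_trans Bm _; apply: box_mono; exact: leq_maxl.
apply: eq_eseriesr => i _; rewrite /= /pushforward /mrestr; congr (P _).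
by apply/seteqP; split => w /= [] // [].
Qed.

Lemma marked_campbell_measure A : measurable A -> M A = M' A.
Proof.
apply: (measure_unique bounded_rect (fun n => box n `*` setT)).
- rewrite measurable_prod_measurableType; apply/seteqP; split.
    apply: smallest_sub; first exact: smallest_sigma_algebra.
    move=> _ [B mB [C mC <-]].
    rewrite (_ : B `*` C = \bigcup_n ((B `&` box n) `*` C)).
      apply: sigma_algebra_bigcup => n; apply: sub_sigma_algebra.
      exists (B `&` box n), C, n; split => //.
      by apply: measurableI => //; exact: measurable_box.
    rewrite -setX_bigcupl -setI_bigcupr box_cover setIT//.
  apply: smallest_sub; first exact: smallest_sigma_algebra.
  move=> _ [B [C [m [mB Bm mC ->]]]]; apply: sub_sigma_algebra.
  by exists B => //; exists C.
- move=> _ _ [B [C [m [mB Bm mC ->]]]] [B' [C' [m' [mB' Bm' mC' ->]]]].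
  exists (B `&` B'), (C `&` C'), m; split.
  - exact: measurableI.
  - by apply: subset_trans Bm; exact: subIsetl.
  - exact: measurableI.
  - by rewrite setXI.
- by move=> n; exists (box n), setT, n; split => //; exact: measurable_box.
- by rewrite -setX_bigcupl box_cover setXTT.
- exact: M_rect.
- move=> n; rewrite M_rect; last by exists (box n), setT, n; split => //; exact: measurable_box.
  rewrite /M' /= /mscale/= product_measure1E//=; last exact: measurable_box.
  rewrite (leb2_vol (measurable_box n) (@subset_refl _ _)) [U _]probability_setT.
  by rewrite mule1 -EFinM ltry.
Qed.

(** Both sides are measures in f that agree on rectangles with a bounded side by
[marked_campbell_rect]; these generate the sigma-algebra. *)
Lemma marked_campbell (f : (R * R) * R -> \bar R) : measurable_fun setT f ->
  (forall z, 0 <= f z)%E ->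
  (\sum_(i <oo) \int[P]_(w in avoid_set i) f (mark i w) =
   c%:E * \int[leb2 \x U]_z f z)%E.
Proof.
move=> mf f0.
rewrite -(@ge0_integral_mscale _ _ _ (leb2 \x U)%E setT measurableT (NngNum c_ge0) f mf
  (fun z _ => f0 z)).
rewrite (eq_measure_integral M); last by move=> A mA _; exact/esym/marked_campbell_measure.
rewrite ge0_integral_measure_series//; apply: eq_eseriesr => i _.
rewrite [RHS](ge0_integral_pushforward (measurable_mark i))//.
have mg : measurable_fun setT (f \o mark i) := measurableT_comp mf (measurable_mark i).
by rewrite (ge0_integral_mrestr P (measurable_avoid_set i) mg (fun w => f0 (mark i w))).
Qed.

End marked_campbell.

(** * Uniform motion along a line *)

Section closest_approach.
Context {R : realType}.
Variable v : R.
Hypothesis v_gt0 : 0 < v.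
Implicit Types (z : (R * R) * R) (t : R).

(** The motion is y + v t e with e = (cos a, sin a): minus the component of y along e, divided by v,
and the component of y across e. *)
Definition tmin z : R := - (z.1.1 * cos z.2 + z.1.2 * sin z.2) / v.
Definition offset z : R := z.1.2 * cos z.2 - z.1.1 * sin z.2.

Lemma dist2E z t :
  (z.1.1 + v * t * cos z.2) ^+ 2 + (z.1.2 + v * t * sin z.2) ^+ 2 =
  offset z ^+ 2 + (v * (t - tmin z)) ^+ 2.
Proof.
rewrite /tmin /offset mulrBr mulrCA divff ?gt_eqF// mulr1.
have := cos2Dsin2 z.2; move: (cos _) (sin _) => c s cs.
rewrite opprK; have s2 : s ^+ 2 = 1 - c ^+ 2 by rewrite -cs addrAC subrr add0r.
transitivity (z.1.1 ^+ 2 + z.1.2 ^+ 2 + 2 * v * t * (z.1.1 * c + z.1.2 * s) +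
  (v * t) ^+ 2 * (c ^+ 2 + s ^+ 2)); first by ring.
transitivity ((z.1.1 ^+ 2 + z.1.2 ^+ 2) * (c ^+ 2 + s ^+ 2) + 2 * v * t * (z.1.1 * c +
  z.1.2 * s) + (v * t) ^+ 2); first by rewrite cs; ring.
ring.
Qed.

(** The Euclidean norm of (sqrt u, a) is 1-Lipschitz in a. *)
Lemma sqrt_lipschitz (u a b : R) : 0 <= u ->
  Num.sqrt (u + a ^+ 2) <= Num.sqrt (u + b ^+ 2) + `|a - b|.
Proof.
move=> u0; have ub : 0 <= u + b ^+ 2 by rewrite addr_ge0 ?sqr_ge0.
rewrite -(ler_pXn2r (ltn0Sn 1)) ?nnegrE ?addr_ge0// sqrrD !sqr_sqrtr ?addr_ge0 ?sqr_ge0//.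
rewrite real_normK ?num_real//.
have h : `|b| * `|a - b| <= Num.sqrt (u + b ^+ 2) * `|a - b|.
  by rewrite ler_wpM2r// -sqrtr_sqr ler_wsqrtr// lerDr.
have : b * (a - b) <= `|b| * `|a - b| by rewrite -normrM ler_norm.
move: h; set p := `|b| * _; set q := _ * `|a - b|.
rewrite -mulr_natr; nra.
Qed.

Section configuration.
Variables (x : nat -> R * R) (th : nat -> R).
Notation mk i := ((x i, th i) : (R * R) * R).

Lemma dist_sqrtE i t : dist v x th i t =
  Num.sqrt (offset (mk i) ^+ 2 + (v * (t - tmin (mk i))) ^+ 2).
Proof. by rewrite /dist /position/= -dist2E. Qed.

Lemma closest_timeE i : closest_time v x th i = tmin (mk i).
Proof.
rewrite /closest_time; set A := [set s | _].
have At : A (tmin (mk i)).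
  move=> t; rewrite !dist_sqrtE subrr mulr0 expr0n addr0 ler_wsqrtr//.
  by rewrite lerDl sqr_ge0.
have : A (get A) by exact: getI At.
move=> /(_ (tmin (mk i))); rewrite !dist_sqrtE subrr mulr0 expr0n addr0.
rewrite ler_sqrt ?addr_ge0 ?sqr_ge0// gerDl => h.
have : (v * (get A - tmin (mk i))) ^+ 2 == 0 by rewrite eq_le h sqr_ge0.
by rewrite sqrf_eq0 mulf_eq0 gt_eqF//= subr_eq0 => /eqP.
Qed.

Lemma closest_distE i : closest_dist v x th i = `|offset (mk i)|.
Proof.
by rewrite /closest_dist closest_timeE dist_sqrtE subrr mulr0 expr0n addr0 sqrtr_sqr.
Qed.

Lemma dist_lipschitz i t t' : dist v x th i t <= dist v x th i t' + v * `|t - t'|.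
Proof.
rewrite !dist_sqrtE; apply: le_trans (sqrt_lipschitz _ (v * (t' - tmin (mk i))) (sqr_ge0 _)) _.
rewrite lerD2l (_ : _ - _ = v * (t - t')); last by ring.
by rewrite normrM gtr0_norm.
Qed.

Lemma dist_ge0 i t : 0 <= dist v x th i t. Proof. by rewrite sqrtr_ge0. Qed.

Lemma dist_lt r i t : 0 <= r -> (dist v x th i t < r) <-> hit (v * t) r (mk i).
Proof.
move=> r0; rewrite /hit/=; set D := (X in X < r ^+ 2).
have D0 : 0 <= D by rewrite addr_ge0 ?sqr_ge0.
have -> : dist v x th i t = Num.sqrt D by [].
have -> : (Num.sqrt D < r) = (D < r ^+ 2).
  by rewrite -[in RHS](sqr_sqrtr D0) ltr_pXn2r ?nnegrE.
by [].
Qed.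

End configuration.

Lemma measurable_cos2 : measurable_fun setT (fun z => cos z.2).
Proof. by apply: measurableT_comp => //; exact: continuous_measurable_fun (@continuous_cos R). Qed.
Lemma measurable_sin2 : measurable_fun setT (fun z => sin z.2).
Proof. by apply: measurableT_comp => //; exact: continuous_measurable_fun (@continuous_sin R). Qed.

Lemma measurable_tmin : measurable_fun setT tmin.
Proof.
have m11 : measurable_fun setT (fun z => z.1.1) by apply: measurableT_comp.
have m12 : measurable_fun setT (fun z => z.1.2) by apply: measurableT_comp.
apply: measurable_funM => //; apply: measurable_funN.
by apply: measurable_funD; apply: measurable_funM => //;
  [exact: measurable_cos2|exact: measurable_sin2].
Qed.

Lemma measurable_offset : measurable_fun setT offset.
Proof.
have m11 : measurable_fun setT (fun z => z.1.1) by apply: measurableT_comp.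
have m12 : measurable_fun setT (fun z => z.1.2) by apply: measurableT_comp.
by apply: measurable_funB; apply: measurable_funM => //;
  [exact: measurable_cos2|exact: measurable_sin2].
Qed.

Definition window : set ((R * R) * R) := [set z | 0 <= tmin z <= 1].

Lemma measurable_window : measurable window.
Proof.
have := measurable_tmin measurableT (measurable_itv `[0, 1]); rewrite setTI.
by congr measurable; apply/seteqP; split => z; rewrite /window/= in_itv.
Qed.

(** For a fixed angle, a rotation sends the coordinates of y to - v * tmin and offset: the window
becomes an interval of length v, and the integral over the other coordinate is Gaussian. *)
Lemma window_integral (U : probability R R) (k : R) : 0 < k ->
  (\int[leb2 \x U]_(z in window) (expR (- k * offset z ^+ 2))%:E =
   (v * Num.sqrt (pi / k))%:E)%E.
Proof.
move=> k0; rewrite integral_mkcond; set g := _ \_ _.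
have mg : measurable_fun setT g.
  apply/(measurable_restrictT _ measurable_window); apply: measurable_funTS.
  apply/measurable_EFinP; apply: measurableT_comp => //.
  by apply: measurable_funM => //; apply: measurable_funX; exact: measurable_offset.
have g0 z : (0 <= g z)%E by rewrite /g patchE; case: ifP => // _; rewrite lee_fin.
rewrite (fubini_tonelli2 _ mg g0)/fubini_G.
transitivity (\int[U]_a (cst (v * Num.sqrt (pi / k))%:E a))%E; last first.
  by rewrite integral_cst// [X in (_ * X)%E](probability_setT U) mule1.
apply: eq_integral => a _ /=.
pose G (y : R * R) : \bar R :=
  (\1_[set` `[(- v)%R, (0 : R)]] y.1 * expR (- k * y.2 ^+ 2))%:E.
have mG : measurable_fun setT G.
  apply/measurable_EFinP; apply: measurable_funM.
    by apply: (measurableT_comp (measurable_indic (measurable_itv _))).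
  apply: measurableT_comp => //.
  by apply: measurable_funM => //; apply: measurable_funX.
have G0 y : (0 <= G y)%E by rewrite lee_fin mulr_ge0.
have ca : (cos a ^+ 2 + (- sin a) ^+ 2 = 1) by rewrite sqrrN cos2Dsin2.
transitivity (\int[leb2]_y G y)%E.
  rewrite -(ge0_integral_rotation ca mG G0); apply: eq_integral => y _.
  rewrite /g patchE /G/= indicE (_ : cos a * y.1 - - sin a * y.2 = cos a * y.1 + sin a * y.2);
    last by ring.
  set A := cos a * y.1 + sin a * y.2.
  have -> : ((y, a) \in window) = (A \in [set` `[(- v)%R, (0 : R)]]).
    have tA : tmin (y, a) = - A / v by rewrite /tmin /A/=; congr (- _ / _); ring.
    apply/idP/idP; rewrite !inE /window/= tA in_itv/= => /andP[h1 h2]; apply/andP; split.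
    - by move: h2; rewrite ler_pdivrMr// mul1r lerNl.
    - by move: h1; rewrite pmulr_lge0 ?invr_gt0// oppr_ge0.
    - by rewrite divr_ge0 ?(ltW v_gt0)// oppr_ge0.
    - by rewrite ler_pdivrMr// mul1r lerNl.
  case: ifP => _; rewrite ?mul1r ?mul0r//; congr (expR (_ * _ ^+ 2))%:E.
  by rewrite /offset/=; ring.
rewrite (ge0_integral_leb2 mG G0).
have gauss : (\int[leb]_y2 (expR (- k * y2 ^+ 2))%:E = (Num.sqrt (pi / k))%:E)%E.
  rewrite ge0_integral_leb//; first exact: integral_gaussian.
  apply/measurable_EFinP; apply: measurableT_comp => //.
  by apply: measurable_funM => //; apply: measurable_funX.
transitivity (\int[leb]_y1 ((Num.sqrt (pi / k))%:E * (\1_[set` `[(- v)%R, (0 : R)]] y1)%:E))%E.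
  apply: eq_integral => y1 _; rewrite /G/=.
  under eq_integral do rewrite EFinM.
  rewrite ge0_integralZl//; last first.
    apply/measurable_EFinP; apply: measurableT_comp => //.
    by apply: measurable_funM => //; apply: measurable_funX.
  by rewrite gauss muleC.
rewrite ge0_integralZl//; last by apply/measurable_EFinP; exact: measurable_indic.
rewrite integral_indic// setIT/= leb_itv ?oppr_le0 ?ltW//.
by rewrite -EFinM; congr EFin; ring.
Qed.

End closest_approach.

(** * Discretization of the time and of the distance of closest approach *)

Section partition.
Context d (T : measurableType d) (R : realType) (mu : {measure set T -> \bar R}).

Lemma partition_integral (l : T -> nat) (f : T -> R) :
  (forall p, measurable [set z | l z = p]) ->
  measurable_fun setT f -> (forall z, 0 <= f z) ->
  (\int[mu]_z (f z)%:E = \sum_(p <oo) \int[mu]_z ((p == l z)%:R * f z)%:E)%E.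
Proof.
move=> ml mf f0; rewrite -integral_nneseries//; last first.
- by move=> p z _; rewrite lee_fin mulr_ge0.
- move=> p; apply/measurable_EFinP; apply: measurable_funM => //.
  apply: (eq_measurable_fun (\1_[set z | l z = p] : _ -> R)).
    move=> z _; rewrite indicE; congr (_%:R); congr nat_of_bool.
    by apply/idP/eqP; rewrite inE/= => ->.
  exact: measurable_indic.
by apply: eq_integral => z _; rewrite (nneseries_single (l z) (f := fun=> f z)).
Qed.

End partition.

Section radii.
Context {R : realType}.

(** Together with [sqr_addr_le]: an additive error b e on a radius a becomes a relative error e on
a^2 plus an error of order e, by 2 a b e <= e (a^2 + b^2). *)
Lemma sqr_subr_ge (e a b : R) : 0 < e <= 1 -> 0 <= a ->
  0 <= b -> (1 - e) * a ^+ 2 - 2 * b ^+ 2 * e <= (Num.max 0 (a - b * e)) ^+ 2.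
Proof.
move=> /andP[e0 e1] a0 b0; have [ab|ba] := leP (a - b * e) 0.
  rewrite expr0n/=; have abe : a <= b * e by lra.
  have a2 : a ^+ 2 <= (b * e) ^+ 2 by rewrite ler_pXn2r ?nnegrE ?mulr_ge0// ltW.
  have e2 : b ^+ 2 * e ^+ 2 <= b ^+ 2 * e by rewrite ler_wpM2l ?sqr_ge0// expr2 ler_piMl// ltW.
  have : 0 <= b ^+ 2 * e by rewrite mulr_ge0 ?sqr_ge0// ltW.
  have : 0 <= e * a ^+ 2 by rewrite mulr_ge0 ?sqr_ge0// ltW.
  by rewrite exprMn in a2; lra.
have : 0 <= e * (a - b) ^+ 2 by rewrite mulr_ge0 ?sqr_ge0// ltW.
have : 0 <= b ^+ 2 * e ^+ 2 by rewrite mulr_ge0 ?sqr_ge0// ltW.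
have : 0 <= b ^+ 2 * e by rewrite mulr_ge0 ?sqr_ge0// ltW.
nra.
Qed.

Lemma sqr_addr_le (e a b : R) : 0 < e <= 1 ->
  (a + b * e) ^+ 2 <= (1 + e) * a ^+ 2 + 2 * b ^+ 2 * e.
Proof.
move=> /andP[e0 e1].
have : 0 <= e * (a - b) ^+ 2 by rewrite mulr_ge0 ?sqr_ge0// ltW.
have e2 : b ^+ 2 * e ^+ 2 <= b ^+ 2 * e by rewrite ler_wpM2l ?sqr_ge0// expr2 ler_piMl// ltW.
nra.
Qed.

End radii.

Section discretization.
Context {R : realType}.
Variables (v u : R).
Hypothesis v_gt0 : 0 < v.
Hypothesis u_ge0 : 0 <= u.
Variable N : nat.
Let e : R := N.+1%:R^-1.
Let n : R := N.+1%:R.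

Let n_gt0 : 0 < n. Proof. by rewrite ltr0n. Qed.
Let e01 : 0 < e <= 1.
Proof. by rewrite invr_gt0 ltr0n/= invf_le1 ?ltr0n// ler1n. Qed.

(** The grid cell of (tmin, |offset|) is coded as one natural number, so that a single series runs
over the cells. *)
Definition label (z : (R * R) * R) : nat :=
  choice.pickle (Num.truncn (n * tmin v z), Num.truncn (n * `|offset z|)).

Definition unlabel (p : nat) : nat * nat := odflt (0, 0)%N (choice.unpickle p).

Lemma labelK z : unlabel (label z) = (Num.truncn (n * tmin v z), Num.truncn (n * `|offset z|)).
Proof. by rewrite /unlabel /label choice.pickleK. Qed.

Lemma measurable_label p : measurable [set z | label z = p].
Proof.
have m1 k : measurable [set z | Num.truncn (n * tmin v z) = k].
  have h : measurable_fun setT (fun z => n * tmin v z).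
    by apply: measurable_funM => //; exact: measurable_tmin.
  by have := h measurableT _ (measurable_truncn_eq k); rewrite setTI.
have m2 k : measurable [set z : (R * R) * R | Num.truncn (n * `|offset z|) = k].
  have h : measurable_fun setT (fun z : (R * R) * R => n * `|offset z|).
    apply: measurable_funM => //; apply: measurableT_comp => //; exact: measurable_offset.
  by have := h measurableT _ (measurable_truncn_eq k); rewrite setTI.
have [[k kp]|nop] := pselect (exists k : nat * nat, choice.pickle k = p).
  rewrite (_ : [set z | _] = [set z | Num.truncn (n * tmin v z) = k.1] `&`
    [set z | Num.truncn (n * `|offset z|) = k.2]); first exact: measurableI.
  apply/seteqP; split => z; rewrite /label -kp /=.
    by move=> /(pcan_inj choice.pickleK) <-.
  by case: k {kp} => k1 k2 /= [-> ->].
rewrite (_ : [set z | _] = set0)// -subset0 => z /= zp; apply: nop.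
by exists (Num.truncn (n * tmin v z), Num.truncn (n * `|offset z|)).
Qed.

Definition time_of p : R := (unlabel p).1%:R * e.
(** The distance that the other stations must keep when the station at hand has offset h. *)
Definition rho (h : R) := Num.sqrt (u + h ^+ 2).
(** The two radii bound the margin [rho] over the whole cell, after allowing for the distance v e
that a station travels within one time step. *)
Definition inner_radius p := Num.max 0 (rho ((unlabel p).2%:R * e) - v * e).
Definition outer_radius p := rho ((unlabel p).2.+1%:R * e) + v * e.

Let trunc_dist (a : R) : 0 <= a -> `|a - (Num.truncn (n * a))%:R * e| <= e.
Proof.
move=> a0; have na0 : 0 <= n * a by rewrite mulr_ge0// ltW.
have /andP[h1 h2] := truncn_itv na0.
have ne : n * e = 1 by rewrite divff ?gt_eqF.
have e0 : 0 < e by case/andP: e01.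
rewrite ger0_norm.
  rewrite -(ler_pM2l n_gt0) mulrBr mulrCA ne mulr1 lerBlDr -natr1 in h2 *; lra.
rewrite subr_ge0 -(ler_pM2l n_gt0) mulrCA ne mulr1//.
Qed.

Lemma time_of_near z : window v z -> v * `|tmin v z - time_of (label z)| <= v * e.
Proof.
move=> /andP[t0 _]; rewrite ler_wpM2l ?(ltW v_gt0)// /time_of labelK/=.
exact: trunc_dist.
Qed.

Let e_ge0 : 0 <= e. Proof. by case/andP: e01 => /ltW. Qed.

Lemma rho_sqr h : rho h ^+ 2 = u + h ^+ 2.
Proof. by rewrite sqr_sqrtr// addr_ge0 ?sqr_ge0. Qed.

Lemma rho_norm h : rho `|h| = rho h.
Proof. by rewrite /rho real_normK ?num_real. Qed.

Lemma rho_ge0 h : 0 <= rho h. Proof. exact: sqrtr_ge0. Qed.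

Lemma rho_floor z : rho (offset z) - e <= rho ((unlabel (label z)).2%:R * e) <= rho (offset z).
Proof.
rewrite labelK/=; have h := trunc_dist (normr_ge0 (offset z)).
apply/andP; split.
  rewrite -[rho (offset z)]rho_norm lerBlDr;
    apply: le_trans (sqrt_lipschitz _ ((Num.truncn (n * `|offset z|))%:R * e) u_ge0) _.
  by rewrite /rho lerD2l.
rewrite -[leRHS]rho_norm ler_wsqrtr// lerD2l ler_pXn2r ?nnegrE ?mulr_ge0//.
rewrite ler_pdivrMr// [leRHS]mulrC.
by have /andP[] := truncn_itv (mulr_ge0 (ltW n_gt0) (normr_ge0 (offset z))).
Qed.

Lemma rho_ceil z : rho (offset z) <= rho ((unlabel (label z)).2.+1%:R * e) <= rho (offset z) + e.
Proof.
rewrite labelK/=; have /andP[h1 /ltW h2] := truncn_itv (mulr_ge0 (ltW n_gt0) (normr_ge0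
  (offset z))).
move: h1 h2; set k := Num.truncn _ => h1 h2.
have k1 : `|offset z| <= k.+1%:R * e by rewrite ler_pdivlMr// mulrC.
have k2 : k%:R * e <= `|offset z| by rewrite ler_pdivrMr// mulrC.
apply/andP; split.
  by rewrite -[leLHS]rho_norm ler_wsqrtr// lerD2l ler_pXn2r ?nnegrE ?mulr_ge0.
rewrite -[rho (offset z)]rho_norm; apply: le_trans (sqrt_lipschitz _ `|offset z| u_ge0) _.
rewrite /rho lerD2l ger0_norm ?subr_ge0//.
by have -> : k.+1%:R * e = k%:R * e + e; [rewrite -natr1 mulrDl mul1r|lra].
Qed.

Lemma inner_radius_ge z :
  (1 - e) * (u + offset z ^+ 2) - 2 * (v + 1) ^+ 2 * e <= inner_radius (label z) ^+ 2.
Proof.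
rewrite -rho_sqr; apply: le_trans (sqr_subr_ge e01 (rho_ge0 _) _) _;
  first by rewrite addr_ge0// ltW.
have max0 (a : R) : 0 <= Num.max 0 a by rewrite le_max lexx.
rewrite /inner_radius ler_pXn2r ?nnegrE ?max0//.
rewrite ge_max max0/= le_max; apply/orP; right.
by have /andP[h _] := rho_floor z; lra.
Qed.

Lemma outer_radius_le z :
  outer_radius (label z) ^+ 2 <= (1 + e) * (u + offset z ^+ 2) + 2 * (v + 1) ^+ 2 * e.
Proof.
rewrite -rho_sqr; apply: le_trans (sqr_addr_le _ _ e01).
rewrite ler_pXn2r ?nnegrE ?addr_ge0 ?rho_ge0 ?mulr_ge0 ?addr_ge0 ?(ltW v_gt0)//.
by have /andP[_ h] := rho_ceil z; rewrite /outer_radius; lra.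
Qed.

Lemma inner_radius_ge0 p : 0 <= inner_radius p.
Proof. by rewrite le_max lexx. Qed.

Lemma outer_radius_ge0 p : 0 <= outer_radius p.
Proof. by rewrite addr_ge0 ?rho_ge0// mulr_ge0// ltW. Qed.

Section config.
Variables (x : nat -> R * R) (th : nat -> R) (i : nat).
Let z j : (R * R) * R := (x j, th j).

(** The margin u is in squared distance: by Poisson void probabilities the squared interferer
distance, and not the distance, has an exponential excess. *)
Definition far := forall j, j <> i ->
  u + offset (z i) ^+ 2 <= dist v x th j (tmin v (z i)) ^+ 2.

Lemma farE : far <-> forall j, j <> i -> rho (offset (z i)) <= dist v x th j (tmin v (z i)).
Proof.
split=> h j ji.
  by rewrite -(ler_pXn2r (ltn0Sn 1)) ?nnegrE ?rho_ge0 ?dist_ge0// rho_sqr; exact: h.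
by rewrite -rho_sqr ler_pXn2r ?nnegrE ?rho_ge0 ?dist_ge0//; exact: h.
Qed.

(** At the grid time, which differs from [tmin] by at most e, any other station is closer than at
[tmin] by at most v e, and the inner radius takes that into account. *)
Lemma far_avoid : window v (z i) -> far -> forall j, j <> i ->
  ~ hit (v * time_of (label (z i))) (inner_radius (label (z i))) (z j).
Proof.
move=> wi /farE h j ji; move=> /(dist_lt _ _ _ _ _ (inner_radius_ge0 _)).
apply/negP; rewrite -leNgt ge_max dist_ge0/= lerBlDr.
have /andP[_ h1] := rho_floor (z i).
apply: le_trans h1 _; apply: le_trans (h j ji) _.
apply: le_trans (dist_lipschitz v_gt0 x th j _ (time_of (label (z i)))) _.
by rewrite lerD2l time_of_near.
Qed.

Lemma avoid_far : window v (z i) -> (forall j, j <> i ->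
  ~ hit (v * time_of (label (z i))) (outer_radius (label (z i))) (z j)) -> far.
Proof.
move=> wi h; apply/farE => j ji.
have : ~ (dist v x th j (time_of (label (z i))) < outer_radius (label (z i))).
  by move=> /(dist_lt _ _ _ _ _ (outer_radius_ge0 _)); exact: h.
move=> /negP; rewrite -leNgt => h1.
have h2 := dist_lipschitz v_gt0 x th j (time_of (label (z i))) (tmin v (z i)).
have h3 := time_of_near wi; rewrite distrC in h3.
by have /andP[h4 _] := rho_ceil (z i); rewrite /outer_radius in h1; lra.
Qed.

End config.

End discretization.

(** * Stations that are closest to the user with a prescribed margin *)

Section far_law.
Context d (T : measurableType d) (R : realType) (P : probability T R).
Variables (lambda v : R) (X : nat -> {RV P >-> (R * R)%type}) (Theta : nat -> {RV P >-> R}).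
Hypothesis lambda_gt0 : 0 < lambda.
Hypothesis v_gt0 : 0 < v.
Hypothesis X_poisson : is_poisson_process lambda X.
Hypothesis Theta_indep : mutually_independent Theta.
Variable U : probability R R.
Hypothesis Theta_law : forall i B, measurable B -> P (Theta i @^-1` B) = U B.
Hypothesis XT : independent_families X Theta.
Variables (u c : R).
Hypothesis u_ge0 : 0 <= u.
Hypothesis c_ge0 : 0 <= c.
Notation mark := (mark X Theta).

Definition far_event i : set T :=
  [set w | window v (mark i w) /\ far v u (fun j => X j w) (fun j => Theta j w) i].

Lemma measurable_offset_mark i : measurable_fun setT (fun w => offset (mark i w)).
Proof. exact: (measurableT_comp (@measurable_offset R) (measurable_mark X Theta i)). Qed.

Lemma measurable_tmin_mark i : measurable_fun setT (fun w => tmin v (mark i w)).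
Proof. exact: (measurableT_comp (@measurable_tmin R v) (measurable_mark X Theta i)). Qed.

Lemma measurable_dist_mark j i : measurable_fun setT
  (fun w => dist v (fun j => X j w) (fun j => Theta j w) j (tmin v (mark i w))).
Proof.
apply: (eq_measurable_fun (fun w => Num.sqrt (offset (mark j w) ^+ 2 +
    (v * (tmin v (mark i w) - tmin v (mark j w))) ^+ 2))).
  by move=> w _; rewrite dist_sqrtE.
apply: measurableT_comp; first exact: continuous_measurable_fun (@sqrt_continuous R).
apply: measurable_funD; apply: measurable_funX; first exact: measurable_offset_mark.
by apply: measurable_funM => //; apply: measurable_funB; exact: measurable_tmin_mark.
Qed.

Lemma measurable_window_mark i : measurable [set w | window v (mark i w)].
Proof.
by have := measurable_mark X Theta i measurableT (@measurable_window R v); rewrite setTI.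
Qed.

Lemma measurable_far_event i : measurable (far_event i).
Proof.
rewrite (_ : far_event i = [set w | window v (mark i w)] `&`
  \bigcap_(j in [set j | j <> i]) [set w | u + offset (mark i w) ^+ 2 <=
     dist v (fun j => X j w) (fun j => Theta j w) j (tmin v (mark i w)) ^+ 2])//.
apply: measurableI; first exact: measurable_window_mark.
apply: bigcap_measurableType => j _.
have m1 : measurable_fun setT (fun w => u + offset (mark i w) ^+ 2).
  by apply: measurable_funD => //; apply: measurable_funX; exact: measurable_offset_mark.
have m2 := measurable_funX 2 (measurable_dist_mark j i).
have := measurable_fun_ler m1 m2 measurableT (_ : measurable [set true]).
by rewrite setTI; apply.
Qed.

Let g (z : (R * R) * R) : R := expR (- c * offset z ^+ 2).
(* The radius may be off by v e, the displacement in one time step, plus e, the rounding of the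
   offset: this is sqr_subr_ge and sqr_addr_le with b = v + 1. *)
Let kappa : R := 2 * (v + 1) ^+ 2.
Let W (e : R) (z : (R * R) * R) : R := \1_(window v) z *
  (lambda * expR (- lambda * (pi * ((1 - e) * (u + offset z ^+ 2) - kappa * e))) * g z).
Let J (e : R) : R := lambda * expR (- lambda * (pi * ((1 - e) * u - kappa * e))) *
  (v * Num.sqrt (pi / (c + lambda * pi * (1 - e)))).

Let g_ge0 z : 0 <= g z. Proof. exact: expR_ge0. Qed.

Let mg : measurable_fun setT g.
Proof.
apply: measurableT_comp => //; apply: measurable_funM => //; apply: measurable_funX.
exact: measurable_offset.
Qed.

Let W_ge0 e z : 0 <= W e z.
Proof. by rewrite !mulr_ge0// ?expR_ge0// ltW. Qed.

Let mW e : measurable_fun setT (W e).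
Proof.
apply: measurable_funM.
  by apply: measurable_indic; exact: measurable_window.
apply: measurable_funM => //; apply: measurable_funM => //.
apply: measurableT_comp => //; apply: measurable_funM => //; apply: measurable_funM => //.
apply: measurable_funB => //; apply: measurable_funM => //; apply: measurable_funD => //.
by apply: measurable_funX; exact: measurable_offset.
Qed.

Let W_integral e : e < 1 -> (\int[leb2 \x U]_z (W e z)%:E = (J e)%:E)%E.
Proof.
move=> e1.
have k0 : 0 < c + lambda * pi * (1 - e).
  by rewrite ltr_wpDl// !mulr_gt0 ?pi_gt0// subr_gt0.
have := window_integral v_gt0 U k0; rewrite integral_mkcond => h.
rewrite /J EFinM -h -ge0_integralZl//; last 3 first.
- apply/(measurable_restrictT _ (@measurable_window R v)); apply: measurable_funTS.
  apply/measurable_EFinP; apply: measurableT_comp => //.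
  by apply: measurable_funM => //; apply: measurable_funX; exact: measurable_offset.
- by move=> z _; rewrite patchE; case: ifP => // _; rewrite lee_fin expR_ge0.
- by rewrite lee_fin mulr_ge0 ?expR_ge0// ltW.
apply: eq_integral => z _; rewrite /W patchE indicE.
case: ifP => _; last by rewrite mul0r mule0.
rewrite mul1r -EFinM; congr EFin; rewrite /g -!mulrA -!expRD; congr (_ * expR _).
ring.
Qed.

Let S : \bar R := (\sum_(i <oo) \int[P]_w (\1_(far_event i) w * g (mark i w))%:E)%E.

Let mfar i : measurable_fun setT (fun w => \1_(far_event i) w * g (mark i w)).
Proof.
apply: measurable_funM.
  by apply: measurable_indic; exact: measurable_far_event.
exact: (measurableT_comp mg (measurable_mark X Theta i)).
Qed.

Section fixed_mesh.
Variable N : nat.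
Let e : R := N.+1%:R^-1.
Notation lab := (label v N).
Let fp p (z : (R * R) * R) : R := (p == lab z)%:R * (\1_(window v) z * g z).

Let mlab_mark i p : measurable [set w | lab (mark i w) = p].
Proof.
by have := measurable_mark X Theta i measurableT (measurable_label v N p); rewrite setTI.
Qed.

Let fp_ge0 p z : (0 <= (fp p z)%:E)%E. Proof. by rewrite lee_fin !mulr_ge0. Qed.

Let mlabE p : measurable_fun setT (fun z => (p == lab z)%:R : R).
Proof.
apply: (eq_measurable_fun (\1_[set z | lab z = p] : _ -> R)).
  move=> z _; rewrite indicE; congr (_%:R); congr nat_of_bool.
  by apply/idP/eqP; rewrite inE/= => ->.
by apply: measurable_indic; exact: measurable_label.
Qed.

Let mfpR p : measurable_fun setT (fp p).
Proof.
apply: measurable_funM; first exact: mlabE.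
by apply: measurable_funM => //; apply: measurable_indic; exact: measurable_window.
Qed.

Let mfp p : measurable_fun setT (fun z => (fp p z)%:E).
Proof. by apply/measurable_EFinP; exact: mfpR. Qed.

Let S_cells : (S = \sum_(p <oo) \sum_(i <oo)
   \int[P]_w ((p == lab (mark i w))%:R * (\1_(far_event i) w * g (mark i w)))%:E)%E.
Proof.
rewrite -nneseries_interchange; last first.
  by move=> i p; apply: integral_ge0 => w _; rewrite lee_fin !mulr_ge0.
apply: eq_eseriesr => i _.
by rewrite (partition_integral P (mlab_mark i) (mfar i))// => w; rewrite mulr_ge0.
Qed.

Let W_cells e' : (\int[leb2 \x U]_z (W e' z)%:E =
   \sum_(p <oo) \int[leb2 \x U]_z ((p == lab z)%:R * W e' z)%:E)%E.
Proof. by rewrite (partition_integral _ (measurable_label v N) (mW e'))//. Qed.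

Let mfar_cell i p : measurable_fun setT
  (fun w => ((p == lab (mark i w))%:R * (\1_(far_event i) w * g (mark i w)))%:E).
Proof.
apply/measurable_EFinP; apply: measurable_funM; last exact: mfar.
exact: (measurableT_comp (mlabE p) (measurable_mark X Theta i)).
Qed.

Let campbell_cell s r p : 0 <= r ->
  (\sum_(i <oo) \int[P]_(w in avoid_set X Theta s r i) (fp p (mark i w))%:E =
   \int[leb2 \x U]_z ((lambda * expR (- lambda * (pi * r ^+ 2))) * fp p z)%:E)%E.
Proof.
move=> r0.
rewrite (marked_campbell lambda_gt0 X_poisson Theta_indep Theta_law XT s r0 (mfp p))//.
rewrite -ge0_integralZl//; last by rewrite lee_fin mulr_ge0 ?expR_ge0// ltW.
Qed.

(** On each cell the event implies avoidance of a disc with fixed time and radius, to which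
[marked_campbell] applies; the weights of all cells add up to at most [W e], whose integral is [J
e]. *)
Lemma far_upper : (0 < N)%N -> (S <= (J e)%:E)%E.
Proof.
move=> N0.
have e1 : e < 1 by rewrite invf_lt1 ?ltr0n// ltr1n.
rewrite -W_integral// S_cells W_cells; apply: lee_nneseries => [p _ _|p _].
  by apply: nneseries_ge0 => i _ _; apply: integral_ge0 => w _; rewrite lee_fin !mulr_ge0.
apply: (@le_trans _ _ (\sum_(i <oo)
   \int[P]_(w in avoid_set X Theta (v * time_of N p) (inner_radius v u N p) i)
     (fp p (mark i w))%:E)%E).
  apply: lee_nneseries => [i _ _|i _].
    by apply: integral_ge0 => w _; rewrite lee_fin !mulr_ge0.
  rewrite [leRHS]integral_mkcond; apply: ge0_le_integral => //.
  - by move=> w _; rewrite lee_fin !mulr_ge0.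
  - apply/(measurable_restrictT _ (measurable_avoid_set X Theta _ _ i)); apply: measurable_funTS.
    exact: (measurableT_comp (mfp p) (measurable_mark X Theta i)).
  move=> w _; rewrite patchE indicE; case: (boolP (w \in far_event i)) => [|_]; last first.
    by rewrite mul0r mulr0; case: ifP.
  rewrite inE mul1r => -[wi fari]; case: eqP => [pl|_]; last first.
    by rewrite mul0r; case: ifP.
  rewrite mem_set; last first.
    by move=> j ji; rewrite pl; exact: (far_avoid v_gt0 u_ge0 wi fari).
  by rewrite lee_fin /fp indicE mem_set// pl eqxx !mul1r.
rewrite campbell_cell ?inner_radius_ge0//; apply: ge0_le_integral => //.
- by move=> z _; rewrite lee_fin mulr_ge0// ?mulr_ge0 ?expR_ge0// ltW.
- by apply/measurable_EFinP; apply: measurable_funM => //; exact: mfpR.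
- by apply/measurable_EFinP; apply: measurable_funM; [exact: mlabE|exact: mW].
move=> z _; rewrite lee_fin /fp; case: eqP => [->|_]; last by rewrite !mul0r mulr0.
rewrite !mul1r /W mulrCA ler_wpM2l// ler_wpM2r// ler_wpM2l ?(ltW lambda_gt0)//.
rewrite ler_expR !mulNr lerN2 !ler_wpM2l ?pi_ge0 ?(ltW lambda_gt0)//.
exact: inner_radius_ge.
Qed.

Lemma far_lower : (0 < N)%N -> ((J (- e))%:E <= S)%E.
Proof.
move=> N0.
have e0 : 0 < e by rewrite invr_gt0 ltr0n.
rewrite -W_integral; last by lra.
rewrite S_cells W_cells; apply: lee_nneseries => [p _ _|p _].
  by apply: integral_ge0 => z _; rewrite lee_fin mulr_ge0//; exact: W_ge0.
apply: (@le_trans _ _ (\sum_(i <oo)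
   \int[P]_(w in avoid_set X Theta (v * time_of N p) (outer_radius v u N p) i)
     (fp p (mark i w))%:E)%E); last first.
  apply: lee_nneseries => [i _ _|i _].
    by apply: integral_ge0 => w _; exact: fp_ge0.
  rewrite [leLHS]integral_mkcond; apply: ge0_le_integral => //.
  - by move=> w _; rewrite patchE; case: ifP => // _; exact: fp_ge0.
  - apply/(measurable_restrictT _ (measurable_avoid_set X Theta _ _ i)); apply: measurable_funTS.
    exact: (measurableT_comp (mfp p) (measurable_mark X Theta i)).
  move=> w _; rewrite patchE; case: ifPn => [|_]; last by rewrite lee_fin !mulr_ge0.
  rewrite inE /fp => av; case: eqP => [pl|_]; last by rewrite !mul0r.
  rewrite !indicE; case: (boolP (mark i w \in window v)) => [|_]; last first.
    by rewrite mul0r mulr0 lee_fin !mulr_ge0.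
  rewrite inE => wi; rewrite mem_set//; split => //.
  apply: (avoid_far (N := N) v_gt0 u_ge0 wi) => j ji; rewrite -pl; exact: av.
rewrite campbell_cell ?outer_radius_ge0//; apply: ge0_le_integral => //.
- by move=> z _; rewrite lee_fin mulr_ge0//; exact: W_ge0.
- by apply/measurable_EFinP; apply: measurable_funM; [exact: mlabE|exact: mW].
- by apply/measurable_EFinP; apply: measurable_funM => //; exact: mfpR.
move=> z _; rewrite lee_fin /fp; case: eqP => [->|_]; last by rewrite !mul0r mulr0.
rewrite !mul1r /W [leRHS]mulrCA ler_wpM2l// ler_wpM2r// ler_wpM2l ?(ltW lambda_gt0)//.
rewrite ler_expR !mulNr lerN2 !ler_wpM2l ?pi_ge0 ?(ltW lambda_gt0)//.
by rewrite opprK mulrN opprK; exact: outer_radius_le.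
Qed.

End fixed_mesh.

(** The two bounds are the values at e and - e of the same continuous function of the mesh. *)
Lemma far_law :
  (\sum_(i <oo) \int[P]_w (\1_(far_event i) w * expR (- c * offset (mark i w) ^+ 2))%:E =
   (lambda * v * Num.sqrt (pi / (c + lambda * pi)) * expR (- (lambda * pi) * u))%:E)%E.
Proof.
rewrite -/S (_ : _ * expR _ = J 0); last first.
  rewrite /J (_ : c + lambda * pi * (1 - 0) = c + lambda * pi); last by ring.
  by rewrite (_ : - lambda * (pi * ((1 - 0) * u - kappa * 0)) = - (lambda * pi) * u); ring.
apply: squeeze_inv; last by move=> N N0; split; [exact: far_lower|exact: far_upper].
rewrite /J; apply: cvgM.
  apply: cvgM; first exact: cvg_cst.
  apply: continuous_comp; last exact: continuous_expR.
  apply: cvgM; first exact: cvg_cst.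
  apply: cvgM; first exact: cvg_cst.
  apply: cvgB; apply: cvgM; try exact: cvg_cst; last exact: cvg_id.
  by apply: cvgB; [exact: cvg_cst|exact: cvg_id].
apply: cvgM; first exact: cvg_cst.
apply: continuous_comp; last exact: sqrt_continuous.
apply: cvgM; first exact: cvg_cst.
apply: cvgV.
  by rewrite subr0 mulr1 gt_eqF// ltr_wpDl// mulr_gt0 ?pi_gt0.
apply: cvgD; first exact: cvg_cst.
apply: cvgM; first exact: cvg_cst.
by apply: cvgB; [exact: cvg_cst|exact: cvg_id].
Qed.

End far_law.

(** * Integrals over the times at which the signal is maximal *)

Section lower_integral.
Context d (T : measurableType d) (R : realType) (mu : {measure set T -> \bar R}).

Import HBNNSimple.

(** The sum over the random set of times is not known to be measurable; being almost everywhere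
equal to a measurable function is enough, as the integral is a supremum over simple functions
below it. *)
Lemma ge0_ae_eq_integral_measurable (f g : T -> \bar R) : measurable_fun setT g ->
  (forall x, 0 <= f x)%E -> (forall x, 0 <= g x)%E ->
  {ae mu, forall x, f x = g x} -> (\int[mu]_x f x = \int[mu]_x g x)%E.
Proof.
move=> mg f0 g0 [A [mA A0 fgA]].
apply/eqP; rewrite eq_le; apply/andP; split.
  rewrite ge0_integralTE//; apply: ge_ereal_sup => _ [h hf <-].
  have -> : sintegral mu h = (\int[mu]_x (h x)%:E)%E by rewrite integral_nnsfun// patch_setT.
  apply: ae_ge0_le_integral => //.
  - by move=> x _; rewrite lee_fin.
  - exact/measurable_EFinP.
  - exists A; split => // x /= nx; apply: fgA => /= fx; apply: nx => _.
    by rewrite -fx; exact: hf.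
rewrite (ge0_negligible_integral mA measurableT mg (fun x _ => g0 x) A0).
rewrite setTD integral_mkcond.
rewrite ge0_integralTE; last by move=> x; rewrite patchE; case: ifP.
rewrite [leRHS]ge0_integralTE//; apply: ereal_sup_le => _ [h hg <-]; exists h => // x;
  apply: le_trans (hg x) _; rewrite patchE; case: ifPn => // xA.
suff -> : f x = g x by [].
apply: contrapT => fx; move: xA; rewrite inE; apply; exact: fgA.
Qed.
End lower_integral.

Section layer_cake.
Context {R : realType}.

Lemma measurable_exponential_tail (b W : R) :
  measurable_fun setT (fun s => (exponential_pdf b s * (s <= W)%R%:R)%:E).
Proof.
apply/measurable_EFinP; apply: measurable_funM; first exact: measurable_exponential_pdf.
apply: (eq_measurable_fun (\1_[set` `]-oo, W]] : _ -> R)).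
  by move=> s _; rewrite indicE mem_setE in_itv.
exact: measurable_indic.
Qed.

(** The second term is the exponential distribution function at W. *)
Lemma layer_cake (b W : R) : 0 < b -> 0 <= W ->
  ((expR (- b * W))%:E + \int[leb]_s (exponential_pdf b s * (s <= W)%R%:R)%:E = 1)%E.
Proof.
move=> b0; have b0' := ltW b0.
have mI := measurable_exponential_tail b W.
have I0 s : (0 <= (exponential_pdf b s * (s <= W)%R%:R)%:E)%E.
  by rewrite lee_fin mulr_ge0// exponential_pdf_ge0.
have E : (\int[leb]_s (exponential_pdf b s * (s <= W)%R%:R)%:E =
    \int[lebesgue_measure]_(s in [set` `[0%R, W]]) (exponential_pdf b s)%:E)%E.
  rewrite ge0_integral_leb// [RHS]integral_mkcond; apply: eq_integral => s _.
  rewrite patchE mem_setE in_itv/=; have [s0|s0] := leP 0 s.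
    by rewrite /=; case: (s <= W)%R; rewrite ?mulr1 ?mulr0.
  by rewrite lt0_exponential_pdf// mul0r.
rewrite E le_eqVlt => /predU1P[<-|W0].
  by rewrite mulr0 expR0 set_itv1 integral_set1 adde0.
by rewrite [X in (_ + X)%E](exponential_prob_itv0c b W0) -EFinB -EFinD; congr EFin; ring.
Qed.
End layer_cake.

Section interferer.
Context {R : realType}.
Variable v : R.
Hypothesis v_gt0 : 0 < v.
Variables (x : nat -> R * R) (th : nat -> R) (i : nat).
Notation z j := ((x j, th j) : (R * R) * R).

(** The interferer distance, when the serving station is i, as a function of the configuration
alone. *)
Definition second_dist : R := inf [set dist v x th j (tmin v (z i)) | j in [set j | j <> i]].

Lemma second_dist_ge r : r <= second_dist <->
  forall j, j <> i -> r <= dist v x th j (tmin v (z i)).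
Proof.
have ne : [set dist v x th j (tmin v (z i)) | j in [set j | j <> i]] !=set0.
  by exists (dist v x th i.+1 (tmin v (z i))), i.+1 => //=; apply/eqP; rewrite gtn_eqF.
have lb : has_lbound [set dist v x th j (tmin v (z i)) | j in [set j | j <> i]].
  by exists 0 => _ [j _ <-]; exact: dist_ge0.
split=> [h j ji|h].
  by apply: le_trans h _; apply: ge_inf => //; exists j.
by apply: lb_le_inf => // _ [j ji <-]; exact: h.
Qed.

Lemma second_dist_ge0 : 0 <= second_dist.
Proof. by apply/second_dist_ge => j _; exact: dist_ge0. Qed.

(** The event in terms of the gap R^2 - H^2, whose tail it describes. *)
Lemma far_second u : 0 <= u ->
  far v u x th i <-> u <= second_dist ^+ 2 - offset (z i) ^+ 2.
Proof.
move=> u0; rewrite lerBrDr -rho_sqr//.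
have -> : (rho u (offset (z i)) ^+ 2 <= second_dist ^+ 2) = (rho u (offset (z i)) <= second_dist).
  by rewrite ler_pXn2r ?nnegrE ?rho_ge0 ?second_dist_ge0.
by split=> [/(farE v u0 x th i)/second_dist_ge|/second_dist_ge h]; last exact/(farE v u0 x th i).
Qed.

Lemma serves_atE s : serves_at v x th s i <-> s = tmin v (z i) /\ far v 0 x th i.
Proof.
have rho0 : rho 0 (offset (z i)) = `|offset (z i)| by rewrite /rho add0r sqrtr_sqr.
rewrite /serves_at closest_timeE// closest_distE//; split=> -[-> h]; split=> //.
  apply/(farE v (lexx 0) x th i) => j ji; rewrite rho0 leNgt; apply/negP => dj.
  by apply: h; exists j.
move=> [j ji dj]; move/(farE v (lexx 0) x th i) : h => /(_ _ ji).
by rewrite rho0 leNgt dj.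
Qed.

End interferer.

Section dedup.
Context {R : realType}.
Variable v : R.
Hypothesis v_gt0 : 0 < v.
Variables (x : nat -> R * R) (th : nat -> R).
Notation z j := ((x j, th j) : (R * R) * R).
Let A : set nat := [set i | window v (z i) /\ far v 0 x th i].
Hypothesis no_tie : forall i, A i -> exists2 u, 0 < u & far v u x th i.

Let tmin_inj i k : A i -> far v 0 x th k -> tmin v (z i) = tmin v (z k) -> i = k.
Proof.
move=> Ai fk ik; apply: contrapT => nik.
have [u u0 fu] := no_tie Ai.
have := fk i nik; have := fu k (fun e => nik (esym e)).
rewrite !dist_sqrtE// ik !subrr !mulr0 expr0n/= !addr0 !sqr_sqrtr ?sqr_ge0//; lra.
Qed.

(** In the absence of ties two serving stations cannot share their time: each would be at the
minimal distance, hence within the margin of the other. *)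
Lemma max_signal_bij : set_bij A (max_signal v x th `&` `[0, 1]) (fun i => tmin v (z i)).
Proof.
split.
- move=> i [wi fi] /=; split; first by exists i; exact/serves_atE.
  by rewrite in_itv/=; exact: wi.
- by move=> i k; rewrite !inE => Ai [_ fk]; exact: tmin_inj.
- move=> s [[i /(serves_atE v_gt0)[si fi]]]; rewrite /= in_itv/= => s01.
  by exists i => //; split => //; rewrite /window/= -si.
Qed.

Lemma serving_stationE i : A i -> serving_station v x th (tmin v (z i)) = i.
Proof.
move=> Ai; have sAi : serves_at v x th (tmin v (z i)) i.
  by apply/serves_atE => //; split=> //; case: Ai.
have : serves_at v x th (tmin v (z i)) (serving_station v x th (tmin v (z i))).
  exact: getI sAi.
by move=> /(serves_atE v_gt0)[ti fi]; apply/esym; exact: tmin_inj fi ti.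
Qed.

Lemma esum_max_signal (f : R -> R -> \bar R) : (forall a b, 0 <= f a b)%E ->
  (\esum_(t in max_signal v x th `&` `[0%R, 1%R])
     f (signal_dist v x th t) (interferer_dist v x th t) =
   \sum_(i <oo) if i \in A then f `|offset (z i)|%R (second_dist v x th i) else 0)%E.
Proof.
move=> f0; rewrite (reindex_esum _ _ _ _ max_signal_bij).
rewrite esum_mkcond nneseries_esumT; last by move=> i; case: ifP.
apply: eq_esum => i _; case: ifPn => //; rewrite inE => Ai.
by rewrite /signal_dist /interferer_dist serving_stationE// closest_distE.
Qed.

End dedup.

(** * Joint law under the Palm probability *)

Section palm_computation.
Context d (T : measurableType d) (R : realType) (P : probability T R).
Variables (lambda v : R) (X : nat -> {RV P >-> (R * R)%type}) (Theta : nat -> {RV P >-> R}).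
Hypothesis lambda_gt0 : 0 < lambda.
Hypothesis v_gt0 : 0 < v.
Hypothesis X_poisson : is_poisson_process lambda X.
Hypothesis Theta_indep : mutually_independent Theta.
Variable U : probability R R.
Hypothesis Theta_law : forall i B, measurable B -> P (Theta i @^-1` B) = U B.
Hypothesis XT : independent_families X Theta.
Notation mark := (mark X Theta).
Notation xs w := (fun j => X j w).
Notation ths w := (fun j => Theta j w).
Notation F u i := (far_event v X Theta u i).

(** The right-hand side of [far_law]; in u it is proportional to the tail of an exponential law of
rate lambda pi. *)
Definition far_mass (c u : R) : R :=
  lambda * v * Num.sqrt (pi / (c + lambda * pi)) * expR (- (lambda * pi) * u).

Lemma far_massE c u : 0 <= c -> 0 <= u ->
  (\sum_(i <oo) \int[P]_w (\1_(F u i) w * expR (- c * offset (mark i w) ^+ 2))%:E =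
   (far_mass c u)%:E)%E.
Proof. by move=> c0 u0; exact:
  (far_law lambda_gt0 v_gt0 X_poisson Theta_indep Theta_law XT u0 c0). Qed.

Lemma far_probE u : 0 <= u -> (\sum_(i <oo) P (F u i) = (far_mass 0 u)%:E)%E.
Proof.
move=> u0; rewrite -far_massE//; apply: eq_eseriesr => i _.
rewrite -[X in P X]setIT -integral_indic//; last exact: measurable_far_event.
by apply: eq_integral => w _; rewrite oppr0 mul0r expR0 mulr1.
Qed.

Lemma far_event_sub u i : 0 <= u -> F u i `<=` F 0 i.
Proof.
move=> u0 w [wi fu]; split => // z j ji; move: (fu j ji); apply: le_trans.
by rewrite lerD2r.
Qed.

(** A tie is the difference between the event with margin 0 and the union of the events with margins
1/(n+1), and the total mass of the latter tends to that of the former. *)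
Lemma ties_null : {ae P, forall w, forall i, F 0 i w -> exists2 u, 0 < u & F u i w}.
Proof.
apply: ae_foralln => i.
pose D := F 0 i `\` \bigcup_n F n.+1%:R^-1 i.
have mF u k : measurable (F u k) by exact: measurable_far_event.
have mD : measurable D by apply: measurableD => //; exact: bigcupT_measurable.
suff PD0 : P D = 0%E.
  exists D; split => // w /= h; split; first by apply: contrapT => nF; apply: h => /nF.
  move=> [n _ Fn]; apply: h => _; exists n.+1%:R^-1.
    by rewrite invr_gt0 ltr0n.
  exact: Fn.
have PDfin : P D \is a fin_num by exact: fin_num_measure.
have Dle u : 0 <= u -> (exists n, u =
  n.+1%:R^-1) -> (P D + (far_mass 0 u)%:E <= (far_mass 0 0)%:E)%E.
  move=> u0 [n un]; rewrite -!far_probE//.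
  have -> : (P D = \sum_(j <oo) ((j == i)%:R * fine (P D))%:E)%E.
    by rewrite (nneseries_single i (f := fun=> fine (P D))) ?fineK// => _; exact: fine_ge0.
  rewrite -nneseriesD//; last by move=> j _ _; rewrite lee_fin mulr_ge0// fine_ge0.
  apply: lee_nneseries => [j _ _|j _].
    by rewrite adde_ge0// lee_fin mulr_ge0// fine_ge0.
  have [ji|ji] := eqVneq j i; last first.
    rewrite mul0r add0e; apply: le_measure; rewrite ?inE//; exact: far_event_sub.
  rewrite mul1r fineK// ji -measureU//; last first.
    by apply/seteqP; split => // w [[_ nF] Fu]; apply: nF; exists n => //; rewrite -un.
  apply: le_measure; rewrite ?inE//; first exact: measurableU.
  by move=> w [[]//|]; exact: far_event_sub.
move: Dle; rewrite -(fineK PDfin); set r := fine (P D) => Dle.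
have r0 : 0 <= r by rewrite fine_ge0.
congr EFin; apply/eqP; rewrite eq_le r0 andbT.
pose K := far_mass 0 0; pose a := lambda * pi.
have K0 : 0 <= K by rewrite !mulr_ge0 ?expR_ge0// ltW.
have rn (n : nat) : r <= K * a * n.+1%:R^-1.
  have u0 : 0 <= n.+1%:R^-1 :> R by rewrite invr_ge0.
  have := Dle _ u0 (ex_intro _ n erefl).
  rewrite -EFinD lee_fin.
  have -> : far_mass 0 n.+1%:R^-1 = K * expR (- a * n.+1%:R^-1).
    by rewrite /K /far_mass mulr0 expR0 mulr1.
  have := expR_ge1Dx (- a * n.+1%:R^-1); rewrite -/K.
  move=> /(ler_wpM2l K0); set E := K * expR _; set t := n.+1%:R^-1.
  by rewrite mulrDr mulr1; lra.
have c1 : K * a * n.+1%:R^-1 @[n --> \oo] --> (0 : R).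
  by rewrite -[X in _ --> X](mulr0 (K * a)); apply: cvgM; [exact: cvg_cst|exact: cvg_harmonic].
by apply: (ler_cvg_to (cvg_cst r) c1); apply: nearW => n; exact: rn.
Qed.

Definition second i w := second_dist v (xs w) (ths w) i.

Lemma measurable_second i : measurable_fun setT (second i).
Proof.
(* The infimum over j != i as the infimum of a sequence: index i repeats the term i + 1. *)
pose h n w := dist v (xs w) (ths w) (if n == i then i.+1 else n) (tmin v (mark i w)).
apply: (eq_measurable_fun (fun w => infs (h ^~ w) 0)).
  move=> w _; rewrite /infs /second /second_dist; congr inf.
  apply/seteqP; split => [_ [n _ <-]|_ [j ji <-]] /=.
    exists (if n == i then i.+1 else n) => //=.
    by case: (eqVneq n i) => [_|/eqP//]; apply/eqP; rewrite gtn_eqF.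
  by exists j => //; rewrite /h; case: eqP ji.
apply: measurable_fun_infs.
  by move=> w _; exists 0 => _ [n _ <-]; exact: dist_ge0.
by move=> n; exact: measurable_dist_mark.
Qed.

Lemma far_event_indic u i w : 0 <= u ->
  (\1_(F u i) w : R) = \1_(F 0 i) w * (u <= second i w ^+ 2 - offset (mark i w) ^+ 2)%R%:R.
Proof.
move=> u0; rewrite !indicE -natrM mulnb; congr (_%:R); congr nat_of_bool.
apply/idP/andP.
  rewrite inE => Fu; split; first by rewrite inE; exact: far_event_sub Fu.
  by case: Fu => _ /(far_second v _ _ _ u0).
move=> [+ h]; rewrite !inE => -[wi _]; split => //.
exact/(far_second v _ _ _ u0).
Qed.

Section weighted.
Variables (beta c : R).
Hypothesis beta_ge0 : 0 <= beta.
Hypothesis c_ge0 : 0 <= c.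

Let gap i w := second i w ^+ 2 - offset (mark i w) ^+ 2.
Let g i w : R := \1_(F 0 i) w * expR (- c * offset (mark i w) ^+ 2).

Let mgap i : measurable_fun setT (gap i).
Proof.
apply: measurable_funB; apply: measurable_funX.
  exact: measurable_second.
exact: measurable_offset_mark.
Qed.

Let mg i : measurable_fun setT (g i).
Proof.
apply: measurable_funM; first by apply: measurable_indic; exact: measurable_far_event.
apply: measurableT_comp => //; apply: measurable_funM => //; apply: measurable_funX.
exact: measurable_offset_mark.
Qed.

Let g0 i w : 0 <= g i w. Proof. by rewrite mulr_ge0 ?expR_ge0. Qed.

Let mf i : measurable_fun setT (fun w => (g i w * expR (- beta * gap i w))%:E).
Proof.
apply/measurable_EFinP; apply: measurable_funM => //.
by apply: measurableT_comp => //; apply: measurable_funM.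
Qed.

Let f0 i w : (0 <= (g i w * expR (- beta * gap i w))%:E)%E.
Proof. by rewrite lee_fin mulr_ge0 ?expR_ge0. Qed.

Let k i (z : T * R) : \bar R :=
  (g i z.1 * (exponential_pdf beta z.2 * (z.2 <= gap i z.1)%R%:R))%:E.

Let mk i : measurable_fun setT (k i).
Proof.
apply/measurable_EFinP; apply: measurable_funM.
  exact: (measurableT_comp (mg i) measurable_fst).
apply: measurable_funM.
  exact: (measurableT_comp (measurable_exponential_pdf _) measurable_snd).
apply: (eq_measurable_fun (\1_[set z : T * R | z.2 <= gap i z.1] : _ -> R)).
  by move=> z _; rewrite indicE; congr (_%:R); congr nat_of_bool; apply/idP/idP; rewrite inE.
apply: measurable_indic.
have := measurable_fun_ler (measurable_snd : measurable_fun [set: T * R] snd)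
   (measurableT_comp (mgap i) measurable_fst) measurableT (_ : measurable [set true]).
by rewrite setTI; apply.
Qed.

Let k0 i z : (0 <= k i z)%E.
Proof. by rewrite lee_fin !mulr_ge0// exponential_pdf_ge0. Qed.

(** Exchanging the integrals, the sum over i at fixed s is [far_mass c s]; against the exponential
density this is a multiple of the exponential density of rate beta + lambda pi. *)
Let tail_integral : 0 < beta ->
  (\sum_(i <oo) \int[P]_w \int[leb]_s (g i w * (exponential_pdf beta s * (s <= gap i w)%R%:R))%:E =
   (far_mass c 0 * (beta / (beta + lambda * pi)))%:E)%E.
Proof.
move=> b0.
have a0 : 0 < lambda * pi by rewrite mulr_gt0 ?pi_gt0.
transitivity (\sum_(i <oo) \int[leb]_s \int[P]_w (g i w * (exponential_pdf beta s *
  (s <= gap i w)%R%:R))%:E)%E.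
  by apply: eq_eseriesr => i _; exact: (fubini_tonelli _ (mk i) (k0 i)).
rewrite -integral_nneseries//; last 2 first.
- by move=> i; exact: (measurable_fun_fubini_tonelli_G _ (mk i) (k0 i)).
- by move=> i s _; apply: integral_ge0 => w _; exact: (k0 i (w, s)).
transitivity (\int[leb]_s ((far_mass c 0 * (beta / (beta + lambda * pi)))%:E *
   (exponential_pdf (beta + lambda * pi) s)%:E))%E.
  apply: eq_integral => s _; have [s0|s0] := leP 0 s; last first.
    rewrite !lt0_exponential_pdf// mule0 eseries0// => i _ _.
    by rewrite integral0_eq// => w _; rewrite mul0r mulr0.
  transitivity (\sum_(i <oo) ((exponential_pdf beta s)%:E *
     \int[P]_w (\1_(F s i) w * expR (- c * offset (mark i w) ^+ 2))%:E))%E.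
    apply: eq_eseriesr => i _; rewrite -ge0_integralZl_EFin//.
    - apply: eq_integral => w _; rewrite -EFinM (far_event_indic _ _ s0) /g /gap; congr (_%:E).
      move: (\1_(F 0 i) w : R) (expR (- c * _)) (_%:R : R) => a1 a2 a3; ring.
    - apply/measurable_EFinP; apply: measurable_funM.
        by apply: measurable_indic; exact: measurable_far_event.
      apply: measurableT_comp => //; apply: measurable_funM => //; apply: measurable_funX.
      exact: measurable_offset_mark.
    - by rewrite exponential_pdf_ge0// ltW.
  rewrite nneseriesZl; last by move=> i _; apply: integral_ge0 => w _;
    rewrite lee_fin mulr_ge0 ?expR_ge0.
  rewrite far_massE// -!EFinM; congr EFin.
  rewrite !exponential_pdfE// /far_mass mulr0 expR0.
  have -> : - (beta + lambda * pi) * s = - beta * s + - (lambda * pi) * s by ring.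
  rewrite expRD; move: (lambda * v * _) => K; move: (lambda * pi) a0 => a a0.
  by field; rewrite gt_eqF// addr_gt0.
have ba0 : 0 < beta + lambda * pi by exact: addr_gt0.
have pdf0 s : setT s -> (0 <= (exponential_pdf (beta + lambda * pi) s)%:E)%E.
  by rewrite lee_fin exponential_pdf_ge0// ltW.
have mpdf : measurable_fun setT (fun s => (exponential_pdf (beta + lambda * pi) s)%:E).
  by apply/measurable_EFinP; exact: measurable_exponential_pdf.
have K0 : (0 <= (far_mass c 0 * (beta / (beta + lambda * pi)))%:E)%E.
  by rewrite lee_fin !mulr_ge0 ?expR_ge0 ?invr_ge0 ?sqrtr_ge0// ltW.
rewrite (ge0_integralZl leb measurableT mpdf pdf0 K0).
rewrite (ge0_integral_leb measurableT mpdf pdf0).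
by rewrite (integral_exponential_pdf ba0) mule1.
Qed.

(** Adding [tail_integral] to the left-hand side gives, by [layer_cake], the same sum with beta = 0,
that is [far_mass c 0]; the ratio lambda pi / (beta + lambda pi) is the Laplace transform of the
exponential law of the gap. *)
Lemma weighted_mass :
  (\sum_(i <oo) \int[P]_w (g i w * expR (- beta * gap i w))%:E =
   (far_mass c 0 * (lambda * pi / (beta + lambda * pi)))%:E)%E.
Proof.
have a0 : 0 < lambda * pi by rewrite mulr_gt0 ?pi_gt0.
move: beta_ge0; rewrite le_eqVlt => /predU1P[b0|b0].
  have a1 : lambda * pi != 0 by rewrite gt_eqF.
  rewrite -b0 add0r (divff a1) mulr1 -(far_massE c_ge0 (lexx 0)).
  apply: eq_eseriesr => i _; apply: eq_integral => w _.
  by rewrite oppr0 mul0r expR0 mulr1.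
have gap0 i w : F 0 i w -> 0 <= gap i w.
  by move=> [_ /(far_second v _ _ _ (lexx 0))].
have E : (\sum_(i <oo) \int[P]_w (g i w * expR (- beta * gap i w))%:E +
  (far_mass c 0 * (beta / (beta + lambda * pi)))%:E = (far_mass c 0)%:E)%E.
  rewrite -(tail_integral b0) -nneseriesD; last 2 first.
  - by move=> i _ _; apply: integral_ge0.
  - by move=> i _ _; apply: integral_ge0 => w _; apply: integral_ge0 => s _; exact: (k0 i (w, s)).
  rewrite -(far_massE c_ge0 (lexx 0)); apply: eq_eseriesr => i _.
  have t0 w : setT w -> (0 <= \int[leb]_s k i (w, s))%E.
    by move=> _; apply: integral_ge0 => s _; exact: k0.
  have mt : measurable_fun setT (fun w => \int[leb]_s k i (w, s))%E.
    exact: (measurable_fun_fubini_tonelli_F _ (mk i) (k0 i)).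
  rewrite -(ge0_integralD P measurableT (fun w _ => f0 i w) (mf i) t0 mt).
  apply: eq_integral => w _; rewrite /k/= -/(g i w).
  have [Fw|nFw] := pselect (F 0 i w); last first.
    have gw : g i w = 0 by rewrite /g indicE memNset ?mul0r.
    by rewrite gw mul0r integral0_eq ?add0e// => s _; rewrite mul0r.
  under eq_integral do rewrite EFinM.
  rewrite ge0_integralZl; last 4 first.
  - exact: measurableT.
  - exact: measurable_exponential_tail.
  - by move=> s _; rewrite lee_fin mulr_ge0// exponential_pdf_ge0.
  - by rewrite lee_fin.
  rewrite EFinM -ge0_muleDr ?lee_fin ?expR_ge0//; last first.
    by apply: integral_ge0 => s _; rewrite lee_fin mulr_ge0// exponential_pdf_ge0.
  by rewrite layer_cake ?mule1//; exact: gap0.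
move: E; case: (\sum_(i <oo) _)%E => [r| |]//.
rewrite -EFinD => -[E]; congr EFin; move: E.
set K := far_mass c 0 => E; apply: (addIr (K * (beta / (beta + lambda * pi)))); rewrite E.
rewrite -mulrDr -mulrDl addrC divff ?mulr1// gt_eqF//.
exact: addr_gt0.
Qed.

End weighted.

(** Almost surely there are no ties, and the times then correspond to the stations that serve at
their own time of closest approach. *)
Lemma palm_sum (f : R -> R -> R) : (forall a b, 0 <= f a b) ->
  (forall i, measurable_fun setT (fun w => f `|offset (mark i w)| (second i w))) ->
  (\int[P]_w (\esum_(t in max_signal v (xs w) (ths w) `&` `[0%R, 1%R])
     (f (signal_dist v (xs w) (ths w) t) (interferer_dist v (xs w) (ths w) t))%:E) =
   \sum_(i <oo) \int[P]_w (\1_(F 0 i) w * f `|offset (mark i w)| (second i w))%:E)%E.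
Proof.
move=> f0 mf.
have m i : measurable_fun setT
    (fun w => (\1_(F 0 i) w * f `|offset (mark i w)| (second i w))%:E).
  apply/measurable_EFinP; apply: measurable_funM (mf i).
  by apply: measurable_indic; exact: measurable_far_event.
have m0 i w : (0 <= (\1_(F 0 i) w * f `|offset (mark i w)| (second i w))%:E)%E.
  by rewrite lee_fin mulr_ge0.
rewrite -(integral_nneseries _ measurableT m (fun i w _ => m0 i w)).
apply: ge0_ae_eq_integral_measurable.
- by apply: ge0_emeasurable_sum => // i w _ _; exact: m0.
- by move=> w; apply: esum_ge0 => t _; rewrite lee_fin.
- by move=> w; apply: nneseries_ge0.
have [A [mA A0 hA]] := ties_null.
exists A; split => // w nw; apply: hA => nt; apply: nw.
have no_tie i : window v (mark i w) /\ far v 0 (xs w) (ths w) i ->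
    exists2 u, 0 < u & far v u (xs w) (ths w) i.
  by move=> /nt[u u0 [_ fu]]; exists u.
have f0' a b : (0 <= (f a b)%:E)%E by rewrite lee_fin.
apply: (etrans (esum_max_signal v_gt0 no_tie f0')).
apply: eq_eseriesr => i _; rewrite indicE; case: ifPn => [|/negP] Fi.
  by rewrite inE in Fi; rewrite mem_set// mul1r.
by rewrite memNset ?mul0r// => Fw; apply: Fi; rewrite inE.
Qed.

End palm_computation.

Unset Implicit Arguments.

Theorem proposition2 (R : realType) (d : measure_display)
    (T : measurableType d) (P : probability T R) (lambda v : R)
    (X : nat -> {RV P >-> (R * R)%type}) (Theta : nat -> {RV P >-> R})
    (lambda_gt0 : 0 < lambda) (v_gt0 : 0 < v)
    (X_poisson : is_poisson_process lambda X)
    (Theta_uniform : iid_uniform_angles Theta)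
    (X_Theta_indep : independent_families X Theta)
    (beta gamma : R) (beta_ge0 : 0 <= beta) (gamma_ge0 : 0 <= gamma) :
  let x w := fun i => X i w in
  let th w := fun i => Theta i w in
  palm_expectation P (fun w => max_signal v (x w) (th w))
    (fun w s => (expR (- gamma * signal_dist v (x w) (th w) s ^+ 2
                       - beta * interferer_dist v (x w) (th w) s ^+ 2))%:E) =
  ((1 + beta / (lambda * pi))^-1 *
   (1 + (gamma + beta) / (lambda * pi)) `^ (- 2^-1))%:E.
Proof.
move=> x th.
have Theta_law i B : measurable B -> P (Theta i @^-1` B) = distribution P (Theta 0) B.
  by move=> mB; rewrite (Theta_uniform.2 0 B mB) -(Theta_uniform.2 i B mB).
have a0 : 0 < lambda * pi by rewrite mulr_gt0 ?pi_gt0.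
have c0 : 0 <= gamma + beta by exact: addr_ge0.
rewrite /palm_expectation /intensity.
have -> : (\int[P]_w (\esum_(t in max_signal v (x w) (th w) `&` `[0%R, 1%R]) 1) =
    (far_mass lambda v 0 0)%:E)%E.
  rewrite (palm_sum lambda_gt0 v_gt0 X_poisson Theta_uniform.1 Theta_law X_Theta_indep
    (f := fun _ _ => 1)).
  - rewrite -(far_massE lambda_gt0 v_gt0 X_poisson Theta_uniform.1 Theta_law X_Theta_indep
      (lexx 0) (lexx 0)).
    apply: eq_eseriesr => i _; apply: eq_integral => w _.
    by rewrite oppr0 mul0r expR0.
  - by [].
  - by move=> i; exact: measurable_cst.
rewrite (palm_sum lambda_gt0 v_gt0 X_poisson Theta_uniform.1 Theta_law X_Theta_indep
    (f := fun a b => expR (- gamma * a ^+ 2 - beta * b ^+ 2))); last 2 first.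
- by move=> a b; exact: expR_ge0.
- move=> i; apply: measurableT_comp => //; apply: measurable_funB; apply: measurable_funM => //.
    apply: measurable_funX; apply: measurableT_comp => //; exact: measurable_offset_mark.
  by apply: measurable_funX; exact: measurable_second.
have -> : (\sum_(i <oo) \int[P]_w (\1_(far_event v X Theta 0 i) w *
     expR (- gamma * `|offset (mark X Theta i w)| ^+ 2 - beta * second v X Theta i w ^+ 2))%:E =
   (far_mass lambda v (gamma + beta) 0 * (lambda * pi / (beta + lambda * pi)))%:E)%E.
  rewrite -(weighted_mass lambda_gt0 v_gt0 X_poisson Theta_uniform.1 Theta_law X_Theta_indep
     beta_ge0 c0).
  apply: eq_eseriesr => i _; apply: eq_integral => w _.
  (* gamma H^2 + beta R^2 = (gamma + beta) H^2 + beta (R^2 - H^2) *)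
  rewrite -mulrA -expRD real_normK ?num_real//; congr (_ * expR _)%:E; ring.
have m0 : 0 < far_mass lambda v 0 0.
  by rewrite /far_mass !mulr_gt0 ?expR_gt0// sqrtr_gt0 divr_gt0 ?pi_gt0// add0r.
rewrite inver gt_eqF// -EFinM; congr EFin.
rewrite powRN powR12_sqrt; last first.
  by rewrite addr_ge0// divr_ge0// ltW.
rewrite /far_mass add0r mulr0 expR0 !mulr1.
have ca0 : 0 < gamma + beta + lambda * pi by exact: ltr_wpDl.
have -> : 1 + (gamma + beta) / (lambda * pi) = (gamma + beta + lambda * pi) / (lambda * pi).
  by rewrite [RHS]mulrDl divff ?gt_eqF// addrC.
have sqrt_div y z : 0 < y -> 0 < z -> Num.sqrt (y / z) = Num.sqrt y / Num.sqrt z :> R.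
  by move=> y0 z0; rewrite sqrtrM ?sqrtrV// ltW.
rewrite !sqrt_div ?pi_gt0//.
have s0 y : 0 < y -> Num.sqrt y != 0 :> R by move=> y0; rewrite gt_eqF// sqrtr_gt0.
move: (s0 _ a0) (s0 _ (pi_gt0 R)) (s0 _ ca0).
move: (Num.sqrt (gamma + beta + lambda * pi)) (Num.sqrt (lambda * pi)) (Num.sqrt pi) => A L p.
have pi0 := lt0r_neq0 (pi_gt0 R).
have la0 := lt0r_neq0 lambda_gt0; have va0 := lt0r_neq0 v_gt0.
have ba0 : beta + lambda * pi != 0 by rewrite gt_eqF// ltr_wpDl.
move: pi pi0 ba0 => q q0 ba0 L0 p0 A0.
by field; rewrite L0 p0 A0 q0 la0 va0 (addrC (lambda * q)) ba0.
Qed.
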